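(* Let $D$ be an integral domain with quotient field $K$, and let $R$ be a pseudo-polynomial retract $D$-algebra such that $\mathrm{Pic}(RK)=(0)$. Let $\Theta$ be a Jaffard family of $D$. Then there is an exact sequence $$0\longrightarrow\mathrm{Pic}(D,\Theta)\longrightarrow\mathrm{Pic}(R)\xrightarrow{\ \pi_\Theta\ }\bigoplus_{T\in\Theta}\mathrm{Pic}(RT)\longrightarrow 0,$$ where the first map is induced by extension of ideals $[I]\mapsto[IR]$ and $\pi_\Theta$ is the extension map $[I]\mapsto([IRT])_{T\in\Theta}$, and $$\mathrm{LPic}(R,D)\simeq\bigoplus_{T\in\Theta}\mathrm{LPic}(RT,T).$$
   Context: All rings are commutative with unit; $D$ is an integral domain that is not a field, with quotient field $K\neq D$. If $A\subseteq B$ are integral domains, the quotient field of $A$ is viewed inside the quotient field of $B$. $\mathrm{Pic}(B)$ is the group of invertible fractional ideals of the domain $B$ modulo nonzero principal fractional ideals; $[I]$ is the class of $I$. A retract $D$-algebra is a $D$-algebra $R$ that is an integral domain and admits a $D$-algebra homomorphism $\epsilon:R\to D$ (then $D\subseteq R$). $R$ is pseudo-polynomial over $D$ (a pseudo-polynomial $D$-algebra) if every principal integral ideal $I\subseteq R$ of $R$ that is unitary with respect to $D$ (i.e. $I\cap K\neq(0)$) is generated by an element of $D$. For an extension $A\subseteq B$ of integral domains, $\mathrm{LPic}(B,A):=\mathrm{Pic}(B)/\iota(\mathrm{Pic}(A))$, where $\iota:\mathrm{Pic}(A)\to\mathrm{Pic}(B)$, $[I]\mapsto[IB]$, is the canonical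 map. An overring of $D$ is a ring between $D$ and $K$; it is flat if it is flat as a $D$-module. For an overring $T$ (including $T=K$), $RT$ is the subring of the quotient field of $R$ consisting of finite sums $\sum r_it_i$ with $r_i\in R$, $t_i\in T$. A Jaffard family of $D$ is a family $\Theta$ of flat overrings of $D$ with $K\notin\Theta$ that is complete ($I=\bigcap_{T\in\Theta}IT$ for every ideal $I$ of $D$), independent ($TT'=K$ for all $T\neq T'$ in $\Theta$) and locally finite (every nonzero $x\in D$ is a non-unit in only finitely many $T\in\Theta$). $\mathrm{Pic}(D,\Theta)$ is the subgroup of $\mathrm{Pic}(D)$ of classes $[I]$ such that $IT$ is principal for every $T\in\Theta$. *)

(* Defs.v *)
From HB Require Import structures.
From mathcomp Require Import all_boot all_order all_algebra.
From mathcomp Require Import fraction generic_quotient ring_quotient.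
From mathcomp Require Import boolp classical_sets functions cardinality.

Set Implicit Arguments.
Unset Strict Implicit.
Unset Printing Implicit Defensive.

Import GRing.Theory.
Local Open Scope classical_set_scope.
Local Open Scope ring_scope.
Local Open Scope quotient_scope.

(** All the integral domains below are subrings of one ambient field [F]; the
    quotient field of such a subring is taken inside [F]. *)

Record subring (F : fieldType) := Subring {
  carrier :> F -> Prop;
  subring1 : carrier 1;
  subringB : forall x y, carrier x -> carrier y -> carrier (x - y);
  subringM : forall x y, carrier x -> carrier y -> carrier (x * y) }.

Section Subrings.
Variable F : fieldType.
Implicit Types (A B : subring F) (I J L : set F).

Lemma subring_inj A B : A = B :> set F -> A = B.
Proof.
case: A B => [A a1 aB aM] [B b1 bB bM] /= E; subst B.
by congr Subring; apply: Prop_irrelevance.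
Qed.

Lemma subring0 A : A 0.
Proof. by rewrite -(subrr 1); apply: subringB; apply: subring1. Qed.
Lemma subringN A x : A x -> A (- x).
Proof. by move=> Ax; rewrite -sub0r; apply: subringB => //; apply: subring0. Qed.
Lemma subringD A x y : A x -> A y -> A (x + y).
Proof. by move=> Ax Ay; rewrite -[y]opprK; apply: subringB => //; apply: subringN. Qed.

Definition frac_set A : set F :=
  [set x | exists a b, [/\ A a, A b, b != 0 & x = a / b]].

Lemma frac_set1 A : frac_set A 1.
Proof.
exists 1, 1; split; [exact: subring1|exact: subring1|exact: oner_neq0|].
by rewrite divr1.
Qed.
Lemma frac_setB A x y : frac_set A x -> frac_set A y -> frac_set A (x - y).
Proof.
move=> [a [b [Aa Ab b0 ->]]] [c [d [Ac Ad d0 ->]]].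
exists (a * d - c * b), (b * d); split.
- by apply: subringB; apply: subringM.
- exact: subringM.
- by rewrite mulf_neq0.
- by rewrite -mulNr addf_div // mulNr.
Qed.
Lemma frac_setM A x y : frac_set A x -> frac_set A y -> frac_set A (x * y).
Proof.
move=> [a [b [Aa Ab b0 ->]]] [c [d [Ac Ad d0 ->]]].
exists (a * c), (b * d); split; rewrite ?mulf_neq0 ?mulf_div //; exact: subringM.
Qed.
Definition frac_ring A : subring F :=
  Subring (@frac_set1 A) (@frac_setB A) (@frac_setM A).

Lemma sub_frac A : A `<=` frac_ring A.
Proof.
move=> x Ax; exists x, 1; split; rewrite ?divr1 ?oner_neq0 //; exact: subring1.
Qed.
Lemma frac_mono A B : A `<=` B -> frac_ring A `<=` frac_ring B.
Proof.
by move=> AB x [a [b [Aa Ab b0 ->]]]; exists a, b; split=> //; apply: AB.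
Qed.

(** The product of two sets: all finite sums of products.  It gives the product
    of fractional ideals, the extensions [IB] and the rings [RT]. *)
Definition mulset I J : set F :=
  [set x | exists s : seq (F * F),
     (forall p, p \in s -> I p.1 /\ J p.2) /\ x = \sum_(p <- s) p.1 * p.2].

Lemma mulset0 I J : mulset I J 0.
Proof. by exists [::]; rewrite big_nil. Qed.
Lemma mulsetD I J x y : mulset I J x -> mulset I J y -> mulset I J (x + y).
Proof.
move=> [s [sIJ ->]] [t [tIJ ->]]; exists (s ++ t); rewrite big_cat; split=> // p.
by rewrite mem_cat => /orP[/sIJ|/tIJ].
Qed.
Lemma mem_mulset I J x y : I x -> J y -> mulset I J (x * y).
Proof.
by move=> Ix Jy; exists [:: (x, y)]; rewrite big_seq1; split=> // p /[1!inE] /eqP->.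
Qed.
Lemma mulset_min I J L : L 0 -> (forall x y, L x -> L y -> L (x + y)) ->
  (forall x y, I x -> J y -> L (x * y)) -> mulset I J `<=` L.
Proof.
move=> L0 LD LM _ [s [sIJ ->]]; elim: s sIJ => [|p s IHs] sIJ; first by rewrite big_nil.
rewrite big_cons; apply: LD.
  by have [] := sIJ p (mem_head _ _); apply: LM.
by apply: IHs => q qs; apply: sIJ; rewrite inE qs orbT.
Qed.
Lemma mulsetS I I' J J' : I `<=` I' -> J `<=` J' -> mulset I J `<=` mulset I' J'.
Proof.
move=> II JJ; apply: mulset_min; [exact: mulset0|exact: mulsetD|].
by move=> x y /II Ix /JJ Jy; apply: mem_mulset.
Qed.
Lemma mulsetC I J : mulset I J = mulset J I.
Proof.
by apply/seteqP; split; apply: mulset_min; do ?[exact: mulset0|exact: mulsetD];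
   move=> x y Ix Jy; rewrite mulrC; apply: mem_mulset.
Qed.
Lemma mulset_subA I J L : mulset (mulset I J) L `<=` mulset I (mulset J L).
Proof.
apply: mulset_min; [exact: mulset0|exact: mulsetD|] => x y IJx Ly.
suff: mulset I J `<=` [set z | mulset I (mulset J L) (z * y)] by exact.
apply: mulset_min => /=; first by rewrite mul0r; apply: mulset0.
  by move=> ? ? ? ?; rewrite mulrDl; apply: mulsetD.
by move=> a b Ia Jb; rewrite -mulrA; apply: mem_mulset => //; apply: mem_mulset.
Qed.
Lemma mulsetA I J L : mulset I (mulset J L) = mulset (mulset I J) L.
Proof.
apply/seteqP; split; last exact: mulset_subA.
rewrite mulsetC [mulset J L]mulsetC [mulset _ L]mulsetC [mulset I J]mulsetC.
exact: mulset_subA.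
Qed.
Lemma mulsetACA I J I' J' :
  mulset (mulset I J) (mulset I' J') = mulset (mulset I I') (mulset J J').
Proof.
by rewrite -!mulsetA; congr mulset; rewrite !mulsetA [mulset J I']mulsetC.
Qed.

Lemma mulset_ringM A B x y :
  mulset A B x -> mulset A B y -> mulset A B (x * y).
Proof.
move=> ABx ABy; have := mem_mulset ABx ABy; rewrite mulsetACA; apply: mulsetS.
  by apply: mulset_min; [exact: subring0|exact: subringD|exact: subringM].
by apply: mulset_min; [exact: subring0|exact: subringD|exact: subringM].
Qed.
Lemma mulset_ring1 A B : mulset A B 1.
Proof. by rewrite -(mulr1 1); apply: mem_mulset; apply: subring1. Qed.
Lemma mulset_ringB A B x y :
  mulset A B x -> mulset A B y -> mulset A B (x - y).
Proof.
move=> ABx ABy; apply: mulsetD => //; rewrite -mulN1r; apply: mulset_ringM => //.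
rewrite -(mulr1 (-1)); apply: mem_mulset; last exact: subring1.
by apply: subringN; apply: subring1.
Qed.
Definition mul_ring A B : subring F :=
  Subring (@mulset_ring1 A B) (@mulset_ringB A B) (@mulset_ringM A B).

Lemma sub_mull A B : A `<=` mul_ring A B.
Proof. by move=> x Ax; rewrite -[x]mulr1; apply: mem_mulset => //; apply: subring1. Qed.
Lemma sub_mulr A B : B `<=` mul_ring A B.
Proof. by move=> x Bx; rewrite -[x]mul1r; apply: mem_mulset => //; apply: subring1. Qed.

Definition submodule A I :=
  [/\ I 0, forall x y, I x -> I y -> I (x + y)
         & forall a x, A a -> I x -> I (a * x)].

Definition ideal A I := I `<=` A /\ submodule A I.

Definition fractional_ideal A I :=
  [/\ I `<=` frac_ring A, submodule A I
    & exists d, [/\ A d, d != 0 & forall x, I x -> A (d * x)]].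

Definition invertible A I :=
  fractional_ideal A I /\
  exists J, fractional_ideal A J /\ mulset I J = A.

Definition span1 A (x : F) : set F := [set x * a | a in A].

Definition principal A I :=
  exists x, [/\ frac_ring A x, x != 0 & I = span1 A x].

Lemma submodule_mul A I J : submodule A I -> submodule A (mulset I J).
Proof.
move=> [I0 ID IM]; split; [exact: mulset0|exact: mulsetD|].
move=> a x Aa; suff: mulset I J `<=` [set z | mulset I J (a * z)] by exact.
apply: mulset_min => /=; first by rewrite mulr0; apply: mulset0.
  by move=> ? ? ? ?; rewrite mulrDr; apply: mulsetD.
by move=> y z Iy Jz; rewrite mulrA; apply: mem_mulset => //; apply: IM.
Qed.

Lemma fractional_ring A : fractional_ideal A A.
Proof.
split; first exact: sub_frac.
  by split; [exact: subring0|exact: subringD|exact: subringM].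
by exists 1; split; rewrite ?oner_neq0 //; [exact: subring1|move=> x; rewrite mul1r].
Qed.

Lemma fractional_mul A I J :
  fractional_ideal A I -> fractional_ideal A J -> fractional_ideal A (mulset I J).
Proof.
move=> [IK Im [d [Ad d0 dI]]] [JK Jm [e [Ae e0 eJ]]]; split.
- apply: mulset_min; [exact: subring0|exact: subringD|] => x y /IK Kx /JK Ky.
  exact: subringM.
- exact: submodule_mul.
- exists (d * e); split; rewrite ?mulf_neq0 //; first exact: subringM.
  apply: mulset_min => /=; first by rewrite mulr0; apply: subring0.
    by move=> ? ? ? ?; rewrite mulrDr; apply: subringD.
  by move=> x y Ix Jy; rewrite mulrACA; apply: subringM; [apply: dI|apply: eJ].
Qed.

Lemma mulset_ringl A I : submodule A I -> mulset A I = I.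
Proof.
move=> [I0 ID IM]; apply/seteqP; split; first by apply: mulset_min.
by move=> x Ix; rewrite -[x]mul1r; apply: mem_mulset => //; apply: subring1.
Qed.

Lemma mulset_id A B : A `<=` B -> mulset A B = B.
Proof.
move=> AB; apply: mulset_ringl; split; [exact: subring0|exact: subringD|].
by move=> a x /AB; apply: subringM.
Qed.

Lemma fractional_ext A B I : A `<=` B ->
  fractional_ideal A I -> fractional_ideal B (mulset I B).
Proof.
move=> AB [IK Im [d [Ad d0 dI]]]; split.
- apply: mulset_min; [exact: subring0|exact: subringD|] => x y /IK Kx By.
  apply: subringM; [exact: (frac_mono AB)|exact: sub_frac].
- by rewrite mulsetC; apply: submodule_mul; have [] := fractional_ring B.
- exists d; split; rewrite //; first exact: AB.
  apply: mulset_min => /=; first by rewrite mulr0; apply: subring0.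
    by move=> ? ? ? ?; rewrite mulrDr; apply: subringD.
  by move=> x y Ix By; rewrite mulrA; apply: subringM => //; apply: AB; apply: dI.
Qed.

Lemma invertible_ring A : invertible A A.
Proof.
split; first exact: fractional_ring.
by exists A; split; [exact: fractional_ring|exact: mulset_id].
Qed.

Lemma invertible_mul A I J :
  invertible A I -> invertible A J -> invertible A (mulset I J).
Proof.
move=> [fI [I' [fI' II']]] [fJ [J' [fJ' JJ']]]; split; first exact: fractional_mul.
exists (mulset I' J'); split; first exact: fractional_mul.
by rewrite mulsetACA II' JJ' mulset_id.
Qed.

Lemma invertible_ext A B I : A `<=` B ->
  invertible A I -> invertible B (mulset I B).
Proof.
move=> AB [fI [J [fJ IJ]]]; split; first exact: (fractional_ext AB fI).
exists (mulset J B); split; first exact: (fractional_ext AB fJ).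
by rewrite mulsetACA IJ !mulset_id.
Qed.

Lemma invertible_inv A I : invertible A I ->
  exists J, invertible A J /\ mulset J I = A.
Proof.
move=> [fI [J [fJ IJ]]]; exists J; rewrite mulsetC; split=> //; split=> //.
by exists I; rewrite mulsetC.
Qed.

Lemma span1M A x y : mulset (span1 A x) (span1 A y) = span1 A (x * y).
Proof.
apply/seteqP; split.
  apply: mulset_min.
  - by exists 0; [exact: subring0|rewrite mulr0].
  - move=> _ _ [a Aa <-] [b Ab <-]; exists (a + b); last by rewrite mulrDr.
    exact: subringD.
  - move=> _ _ [a Aa <-] [b Ab <-]; exists (a * b); last by rewrite mulrACA.
    exact: subringM.
move=> _ [a Aa <-]; rewrite -mulrA [y * a]mulrC mulrA mulrC [x * a]mulrC mulrC.
rewrite [a * x]mulrC; apply: mem_mulset; first by exists a.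
by exists 1; [exact: subring1|rewrite mulr1].
Qed.
Lemma span1_ext A B x : A `<=` B -> mulset (span1 A x) B = span1 B x.
Proof.
move=> AB; apply/seteqP; split.
  apply: mulset_min.
  - by exists 0; [exact: subring0|rewrite mulr0].
  - move=> _ _ [a Aa <-] [b Ab <-]; exists (a + b); last by rewrite mulrDr.
    exact: subringD.
  - move=> _ b [a /AB Ba <-] Bb; exists (a * b); last by rewrite mulrA.
    exact: subringM.
move=> _ [b Bb <-]; apply: mem_mulset => //.
by exists 1; [exact: subring1|rewrite mulr1].
Qed.
Lemma span11 A : span1 A 1 = A.
Proof.
apply/seteqP; split; first by move=> _ [a Aa <-]; rewrite mul1r.
by move=> a Aa; exists a; rewrite ?mul1r.
Qed.
Lemma frac_ringV A x : frac_ring A x -> x != 0 -> frac_ring A x^-1.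
Proof.
move=> [a [b [Aa Ab b0 ->]]] x0; exists b, a; split=> //; last by rewrite invf_div.
by apply: contraNneq x0 => ->; rewrite mul0r.
Qed.
Lemma principal_ring A : principal A A.
Proof. by exists 1; rewrite span11 oner_neq0; split=> //; apply: frac_set1. Qed.
Lemma principal_mul A I J :
  principal A I -> principal A J -> principal A (mulset I J).
Proof.
move=> [x [Kx x0 ->]] [y [Ky y0 ->]]; exists (x * y); rewrite span1M mulf_neq0 //.
by split=> //; apply: frac_setM.
Qed.
Lemma principal_inv A I J : submodule A J ->
  principal A I -> mulset I J = A -> principal A J.
Proof.
move=> Jm [x [Kx x0 ->]] IJ; exists x^-1; rewrite invr_neq0 //.
split=> //; first exact: frac_ringV.
rewrite -[LHS](mulset_ringl Jm) -{1}(span11 A) -(mulVf x0) -span1M -mulsetA IJ.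
by rewrite span1_ext.
Qed.
Lemma principal_ext A B I : A `<=` B -> principal A I -> principal B (mulset I B).
Proof.
move=> AB [x [Kx x0 ->]]; exists x; rewrite span1_ext //; split=> //.
exact: (frac_mono AB).
Qed.

End Subrings.

(** The Picard group, written additively to use the [zmodType] library: in
    [inv_ideal A], the sum is the product of ideals and the zero is [A]. *)

Section Picard.
Variables (F : fieldType) (A : subring F).

Definition inv_ideal := {I : set F | `[< invertible A I >]}.
HB.instance Definition _ := Choice.on inv_ideal.

Definition InvIdeal (I : set F) (h : invertible A I) : inv_ideal :=
  exist _ I (asboolT h).
Lemma inv_idealP (I : inv_ideal) : invertible A (val I).
Proof. exact: asboolW (valP I). Qed.
Lemma inv_submodule (I : inv_ideal) : submodule A (val I).
Proof. by have [[]] := inv_idealP I. Qed.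

Definition inv_zero := InvIdeal (invertible_ring A).
Definition inv_add (I J : inv_ideal) :=
  InvIdeal (invertible_mul (inv_idealP I) (inv_idealP J)).
Definition inv_opp (I : inv_ideal) :=
  let J := cid (invertible_inv (inv_idealP I)) in InvIdeal (proj1 (svalP J)).

Lemma inv_addA : associative inv_add.
Proof. by move=> I J L; apply: val_inj; apply: mulsetA. Qed.
Lemma inv_addC : commutative inv_add.
Proof. by move=> I J; apply: val_inj; apply: mulsetC. Qed.
Lemma inv_add0 : left_id inv_zero inv_add.
Proof. by move=> I; apply: val_inj; apply: mulset_ringl; apply: inv_submodule. Qed.
Lemma inv_addN : left_inverse inv_zero inv_opp inv_add.
Proof.
by move=> I; apply: val_inj; apply: (proj2 (svalP (cid (invertible_inv (inv_idealP I))))).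
Qed.
HB.instance Definition _ :=
  GRing.isZmodule.Build inv_ideal inv_addA inv_addC inv_add0 inv_addN.

Definition principal_pred : {pred inv_ideal} := fun I => `[< principal A (val I) >].

Lemma principal_closed : zmod_closed principal_pred.
Proof.
split; first by apply/asboolP; apply: principal_ring.
move=> I J /asboolP pI /asboolP pJ; apply/asboolP; apply: principal_mul => //.
apply: (principal_inv (inv_submodule _) pJ).
by have /(congr1 val) := addrN J.
Qed.
HB.instance Definition _ :=
  GRing.isZmodClosed.Build inv_ideal principal_pred principal_closed.

Definition Pic := Quotient.quot principal_pred.
HB.instance Definition _ := GRing.Zmodule.on Pic.

Definition cls (I : inv_ideal) : Pic := \pi I.

Lemma clsP (I J : inv_ideal) :
  cls I = cls J <-> principal A (val (I - J)).
Proof.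
split=> [|pIJ].
  by move=> /eqP; rewrite /cls -Quotient.idealrBE => /asboolP.
by apply/eqP; rewrite /cls -Quotient.idealrBE; apply/asboolP.
Qed.
Lemma clsD (I J : inv_ideal) : cls (I + J) = cls I + cls J.
Proof. by rewrite /cls; apply: (raddfD (\pi_(Pic))). Qed.
Lemma clsB (I J : inv_ideal) : cls (I - J) = cls I - cls J.
Proof. by rewrite /cls; apply: (raddfB (\pi_(Pic))). Qed.
Lemma cls0 : cls 0 = 0.
Proof. by rewrite -(subrr 0) clsB subrr. Qed.
Lemma reprE (x : Pic) : cls (repr x) = x.
Proof. exact: reprK. Qed.

End Picard.

Section Extension.
Variables (F : fieldType) (A B : subring F) (AB : A `<=` B).

Definition inv_ext (I : inv_ideal A) : inv_ideal B :=
  InvIdeal (invertible_ext AB (inv_idealP I)).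
Lemma inv_extD : {morph inv_ext : I J / I + J}.
Proof.
move=> I J; apply: val_inj; rewrite /= mulsetACA [mulset B B]mulset_id //.
Qed.
Lemma inv_extB : {morph inv_ext : I J / I - J}.
Proof.
by move=> I J; apply: (addIr (inv_ext J)); rewrite -inv_extD !addrNK.
Qed.

(** [[I] |-> [IB]]; see [pic_extE] for the independence of the representative *)
Definition pic_ext (x : Pic A) : Pic B := cls (inv_ext (repr x)).

Lemma pic_extE (I : inv_ideal A) : pic_ext (cls I) = cls (inv_ext I).
Proof.
apply/clsP; rewrite -inv_extB; apply: (principal_ext AB); apply/clsP.
exact: reprE.
Qed.
Lemma pic_ext_is_zmod_morphism : zmod_morphism pic_ext.
Proof.
move=> x y; rewrite -[x]reprE -[y]reprE -clsB !pic_extE -clsB; congr cls.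
exact: inv_extB.
Qed.
HB.instance Definition _ :=
  GRing.isZmodMorphism.Build (Pic A) (Pic B) pic_ext pic_ext_is_zmod_morphism.

Definition pic_ext_im : {pred Pic B} := fun y => `[< exists x, pic_ext x = y >].
Lemma pic_ext_im_closed : zmod_closed pic_ext_im.
Proof.
split; first by apply/asboolP; exists 0; apply: raddf0.
move=> _ _ /asboolP[x <-] /asboolP[y <-]; apply/asboolP.
by exists (x - y); apply: raddfB.
Qed.
HB.instance Definition _ :=
  GRing.isZmodClosed.Build (Pic B) pic_ext_im pic_ext_im_closed.

Definition LPic := Quotient.quot pic_ext_im.
HB.instance Definition _ := GRing.Zmodule.on LPic.

End Extension.

Section DirectSum.
Variables (I : Type) (V : I -> zmodType).

Definition dsum :=
  {x : forall i, V i | `[< finite_set [set i | x i != 0] >]}.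
HB.instance Definition _ := Choice.on dsum.

Definition dsum_fun (x : dsum) : forall i, V i := val x.
Coercion dsum_fun : dsum >-> Funclass.

Lemma dsumP (x : dsum) : finite_set [set i | x i != 0].
Proof. exact: asboolW (valP x). Qed.
Definition DSum (x : forall i, V i) (h : finite_set [set i | x i != 0]) : dsum :=
  exist _ x (asboolT h).
Lemma dsum_eq (x y : dsum) : (forall i, x i = y i) -> x = y.
Proof. by move=> xy; apply: val_inj; apply: functional_extensionality_dep. Qed.

Lemma dsum0_fin : finite_set [set i | (0 : V i) != 0].
Proof. by apply: (sub_finite_set _ (finite_set0 I)) => i /=; rewrite eqxx. Qed.
Lemma dsumN_fin (x : dsum) : finite_set [set i | - x i != 0].
Proof. by apply: (sub_finite_set _ (dsumP x)) => i /=; rewrite oppr_eq0. Qed.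
Lemma dsumD_fin (x y : dsum) : finite_set [set i | x i + y i != 0].
Proof.
have xy_fin : finite_set ([set i | x i != 0] `|` [set i | y i != 0]).
  by rewrite finite_setU; split; apply: dsumP.
apply: (sub_finite_set _ xy_fin) => i /= xyi; apply/orP; apply: contraNT xyi.
by rewrite negb_or !negbK => /andP[/eqP-> /eqP->]; rewrite addr0.
Qed.
Definition dsum0 := DSum dsum0_fin.
Definition dsumN x := DSum (dsumN_fin x).
Definition dsumD x y := DSum (dsumD_fin x y).

Lemma dsumDA : associative dsumD.
Proof. by move=> x y z; apply: dsum_eq => i; apply: addrA. Qed.
Lemma dsumDC : commutative dsumD.
Proof. by move=> x y; apply: dsum_eq => i; apply: addrC. Qed.
Lemma dsumD0 : left_id dsum0 dsumD.
Proof. by move=> x; apply: dsum_eq => i; apply: add0r. Qed.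
Lemma dsumDN : left_inverse dsum0 dsumN dsumD.
Proof. by move=> x; apply: dsum_eq => i; apply: addNr. Qed.
HB.instance Definition _ := GRing.isZmodule.Build dsum dsumDA dsumDC dsumD0 dsumDN.

End DirectSum.

Section Flat.
Variable A : comNzRingType.

Definition bilinear (M N P : lmodType A) (b : M -> N -> P) :=
  [/\ forall m m' n, b (m + m') n = b m n + b m' n,
      forall m n n', b m (n + n') = b m n + b m n',
      forall a m n, b (a *: m) n = a *: b m n
    & forall a m n, b m (a *: n) = a *: b m n].

(** The sum of the [m (x) n], for [(m, n)] in [s], is zero in [M (x) N]: by the
    universal property of the tensor product, it is killed by every bilinear
    map out of [M * N]. *)
Definition tensor_eq0 (M N : lmodType A) (s : seq (M * N)) :=
  forall (P : lmodType A) (b : M -> N -> P), bilinear b ->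
    \sum_(p <- s) b p.1 p.2 = 0.

(** [id (x) f : M (x) N -> M (x) N'] is injective for every injective [f]. *)
Definition flat (M : lmodType A) :=
  forall (N N' : lmodType A) (f : {linear N -> N'}), injective f ->
  forall s : seq (M * N),
    tensor_eq0 [seq (p.1, f p.2) | p <- s] -> tensor_eq0 s.

End Flat.

Section RingSort.
Variables (F : fieldType) (A : subring F).

Definition mem_subring : {pred F} := fun x => `[< A x >].
Lemma mem_subring_closed : subring_closed mem_subring.
Proof.
split; first by apply/asboolP; apply: subring1.
  by move=> x y /asboolP Ax /asboolP Ay; apply/asboolP; apply: subringB.
by move=> x y /asboolP Ax /asboolP Ay; apply/asboolP; apply: subringM.
Qed.
HB.instance Definition _ :=
  GRing.isSubringClosed.Build F mem_subring mem_subring_closed.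

Definition ring_sort := {x : F | mem_subring x}.
HB.instance Definition _ := SubChoice.on ring_sort.
HB.instance Definition _ := [SubChoice_isSubComNzRing of ring_sort by <:].

Lemma ring_sortP (x : ring_sort) : A (val x).
Proof. exact: asboolW (valP x). Qed.
Definition RingSort x (Ax : A x) : ring_sort := exist _ x (asboolT Ax).

End RingSort.

Record overring (F : fieldType) (A : subring F) := Overring {
  overring_ring :> subring F;
  overring_sub : A `<=` overring_ring;
  overring_frac : overring_ring `<=` frac_ring A }.

Section Overring.
Variables (F : fieldType) (A : subring F).

Lemma overring_inj (T T' : overring A) : T = T' :> set F -> T = T'.
Proof.
case: T T' => [T a b] [T' a' b'] /= /subring_inj E; subst T'.
by congr Overring; apply: Prop_irrelevance.
Qed.

Variable T : overring A.

Definition overring_mod := ring_sort T.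
HB.instance Definition _ := GRing.Zmodule.on overring_mod.

Definition overring_scale (a : ring_sort A) (t : overring_mod) : overring_mod :=
  RingSort (subringM (@overring_sub _ _ T _ (ring_sortP a)) (ring_sortP t)).

Lemma overring_scaleA a b t :
  overring_scale a (overring_scale b t) = overring_scale (a * b) t.
Proof. by apply: val_inj; rewrite /= mulrA. Qed.
Lemma overring_scale1 : left_id 1 overring_scale.
Proof. by move=> t; apply: val_inj; rewrite /= mul1r. Qed.
Lemma overring_scaleDr : right_distributive overring_scale +%R.
Proof. by move=> a t u; apply: val_inj; rewrite /= mulrDr. Qed.
Lemma overring_scaleDl t : {morph overring_scale^~ t : a b / a + b}.
Proof. by move=> a b; apply: val_inj; rewrite /= mulrDl. Qed.
HB.instance Definition _ :=
  GRing.Zmodule_isLmodule.Build (ring_sort A) overring_mod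
    overring_scaleA overring_scale1 overring_scaleDr overring_scaleDl.

End Overring.

Section Jaffard.
Variables (F : fieldType) (A : subring F).
Implicit Types (Theta : set (overring A)) (T : overring A).

Definition complete Theta :=
  forall I, ideal A I -> I = \bigcap_(T in Theta) mulset I T.

Definition independent Theta :=
  forall T T', Theta T -> Theta T' -> T <> T' -> mulset T T' = frac_ring A.

Definition locally_finite Theta :=
  forall x, A x -> x != 0 -> finite_set [set T | Theta T /\ ~ T x^-1].

Definition jaffard_family Theta :=
  [/\ forall T, Theta T -> flat (overring_mod T),
      forall T, Theta T -> T <> frac_ring A :> set F,
      complete Theta, independent Theta & locally_finite Theta].

Variable Theta : set (overring A).

Definition pic_theta_pred : {pred Pic A} := fun x =>
  `[< exists I, x = cls I /\
        forall T, Theta T -> principal T (mulset (val I) T) >].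
Lemma pic_theta_closed : zmod_closed pic_theta_pred.
Proof.
split.
  apply/asboolP; exists 0; rewrite cls0; split=> // T _.
  apply: principal_ext; first exact: overring_sub.
  exact: principal_ring.
move=> _ _ /asboolP[I [-> pI]] /asboolP[J [-> pJ]]; apply/asboolP.
exists (I - J); rewrite clsB; split=> // T ThT.
have AT := @overring_sub _ _ T.
have : principal_pred (inv_ext AT I - inv_ext AT J).
  by apply: rpredB; apply/asboolP; [apply: pI|apply: pJ].
by rewrite -inv_extB => /asboolP.
Qed.
HB.instance Definition _ :=
  GRing.isZmodClosed.Build (Pic A) pic_theta_pred pic_theta_closed.

Definition PicTheta := {x : Pic A | pic_theta_pred x}.
HB.instance Definition _ := SubChoice.on PicTheta.
HB.instance Definition _ := [SubChoice_isSubZmodule of PicTheta by <:].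

End Jaffard.

#[short(type="idomAlgType")]
HB.structure Definition IdomAlgebra (D : idomainType) :=
  {R of GRing.IntegralDomain R & GRing.ComAlgebra D R}.

Definition retract_algebra (D : idomainType) (R : idomAlgType D) :=
  inhabited {lrmorphism R -> D^o}.

(** The images of [R] and of [D] in the quotient field of [R]; the second one is
    a copy of [D] when [R] is a retract algebra. *)

Section Images.
Variables (D : idomainType) (R : idomAlgType D).

Definition embR_set : set {fraction R} := [set tofrac r | r in [set: R]].
Definition embD_set : set {fraction R} :=
  [set tofrac (d%:A : R) | d in [set: D]].

Lemma embR1 : embR_set 1.
Proof. by exists 1; rewrite // rmorph1. Qed.
Lemma embRB x y : embR_set x -> embR_set y -> embR_set (x - y).
Proof. by move=> [a _ <-] [b _ <-]; exists (a - b); rewrite // rmorphB. Qed.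
Lemma embRM x y : embR_set x -> embR_set y -> embR_set (x * y).
Proof. by move=> [a _ <-] [b _ <-]; exists (a * b); rewrite // rmorphM. Qed.
Definition embR : subring {fraction R} := Subring embR1 embRB embRM.

Lemma embD1 : embD_set 1.
Proof. by exists 1; rewrite // scale1r rmorph1. Qed.
Lemma embDB x y : embD_set x -> embD_set y -> embD_set (x - y).
Proof. by move=> [a _ <-] [b _ <-]; exists (a - b); rewrite // scalerBl rmorphB. Qed.
Lemma embDM x y : embD_set x -> embD_set y -> embD_set (x * y).
Proof.
move=> [a _ <-] [b _ <-]; exists (a * b); rewrite // -rmorphM -scalerAl mul1r.
by rewrite scalerA.
Qed.
Definition embD : subring {fraction R} := Subring embD1 embDB embDM.

Lemma embDR : embD `<=` embR.
Proof. by move=> _ [d _ <-]; exists d%:A. Qed.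

End Images.

(** The ideal [aR] is principal and integral, and unitary with respect to [A]
    when it meets the quotient field of [A] outside [0]. *)
Definition pseudo_polynomial (F : fieldType) (A R : subring F) :=
  forall a, R a ->
    (exists2 x, x != 0 & (span1 R a `&` frac_ring A) x) ->
  exists2 d, A d & span1 R a = span1 R d.

Definition short_exact (U V W : zmodType)
    (f : {additive U -> V}) (g : {additive V -> W}) :=
  [/\ injective f, forall y, g y = 0 <-> exists x, f x = y
    & forall z, exists y, g y = z].

(* Main.v *)
Require Import Defs.
From HB Require Import structures.
From mathcomp Require Import all_boot all_algebra fraction.
From mathcomp Require Import generic_quotient ring_quotient.
From mathcomp Require Import ring.
From mathcomp Require Import boolp classical_sets functions cardinality.

Set Implicit Arguments.
Unset Strict Implicit.
Unset Printing Implicit Defensive.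

Import GRing.Theory.
Local Open Scope classical_set_scope.
Local Open Scope ring_scope.
Local Open Scope quotient_scope.

(** Let [J] be an invertible ideal of [R].  As [Pic(RK) = 0], we may scale [J] so
    that [J RK = RK]; then [J] contains some [d != 0] of [D] with [d J `<=` R], so
    [J RT = RT] for every [T] of [Theta] in which [d] is a unit.

    If each [J RT] is [y I RT] for an invertible ideal [I] of [T], then [y] is a
    unit of [RK]; since [R] is pseudo-polynomial, [y] is up to a unit of [R] an
    element of [K], so [J RT = I' RT] for an ideal [I'] of [T].  The retraction
    gives [I' RT `&` K = I'], hence [J `&` K] localizes to these [I'], is
    invertible, and generates [J].  This yields both the kernel of [pi_Theta] and
    the injectivity of the map between the [LPic].

    For the surjectivity, normalized ideals [J_T] of the [RT], almost all trivial,
    are glued into the intersection of the [J_T], which localizes to [J_T] because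
    [T] and the intersection of the other members of [Theta] generate [K]. *)

(** * Quotient modules and the maps induced between them *)

Section QuotientModule.
Variables (A : pzRingType) (V : lmodType A) (P : V -> Prop).

Definition submod_prop := [/\ P 0, forall u v, P u -> P v -> P (u + v)
  & forall a v, P v -> P (a *: v)].

Hypothesis P_submod : submod_prop.

(** The closure proof is an argument so that it stays in the term, where the inference of the group
    structure on the quotient finds it. *)
Definition submod_pred of submod_prop : {pred V} := fun v => `[< P v >].
Local Notation S := (submod_pred P_submod).

Lemma submod_predZ a v : v \in S -> a *: v \in S.
Proof. by have [_ _ PZ] := P_submod; move=> /asboolP Pv; apply/asboolP/PZ. Qed.
Lemma submod_pred_closed : zmod_closed S.
Proof.
have [P0 PD PZ] := P_submod; split=> [|u v /asboolP Pu /asboolP Pv]; apply/asboolP => //.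
by apply: PD => //; rewrite -scaleN1r; apply: PZ.
Qed.
HB.instance Definition _ := GRing.isZmodClosed.Build V S submod_pred_closed.

Definition quot_mod := Quotient.quot S.
HB.instance Definition _ := GRing.Zmodule.on quot_mod.

Definition quot_pi (v : V) : quot_mod := \pi v.

Lemma quot_pi_eq (u v : V) : (quot_pi u == quot_pi v) = (u - v \in S).
Proof. by rewrite /quot_pi -Quotient.idealrBE. Qed.
Lemma quot_piD u v : quot_pi (u + v) = quot_pi u + quot_pi v.
Proof. exact: (raddfD (\pi_quot_mod)). Qed.
Lemma quot_piK (x : quot_mod) : quot_pi (repr x) = x.
Proof. exact: reprK. Qed.
Lemma quot_pi_eq0 (v : V) : quot_pi v = 0 <-> P v.
Proof.
have -> : 0 = quot_pi 0 by apply: (addIr (quot_pi 0)); rewrite -quot_piD !add0r.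
split=> [/eqP|Pv]; first by rewrite quot_pi_eq subr0 => /asboolP.
by apply/eqP; rewrite quot_pi_eq subr0; apply/asboolP.
Qed.

Definition quot_scale (a : A) (x : quot_mod) : quot_mod := quot_pi (a *: repr x).

Lemma quot_scaleE a v : quot_scale a (quot_pi v) = quot_pi (a *: v).
Proof.
apply/eqP; rewrite quot_pi_eq -scalerBr; apply: submod_predZ.
by rewrite -quot_pi_eq quot_piK.
Qed.
Lemma quot_scaleA a b x : quot_scale a (quot_scale b x) = quot_scale (a * b) x.
Proof. by rewrite -[x]quot_piK !quot_scaleE scalerA. Qed.
Lemma quot_scale1 : left_id 1 quot_scale.
Proof. by move=> x; rewrite -[x]quot_piK quot_scaleE scale1r. Qed.
Lemma quot_scaleDr : right_distributive quot_scale +%R.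
Proof.
move=> a x y; rewrite -[x]quot_piK -[y]quot_piK -quot_piD !quot_scaleE scalerDr.
exact: quot_piD.
Qed.
Lemma quot_scaleDl x : {morph quot_scale^~ x : a b / a + b}.
Proof.
by move=> a b; rewrite -[x]quot_piK !quot_scaleE scalerDl; apply: quot_piD.
Qed.
HB.instance Definition _ := GRing.Zmodule_isLmodule.Build A quot_mod
  quot_scaleA quot_scale1 quot_scaleDr quot_scaleDl.

Lemma quot_piZ a v : quot_pi (a *: v) = a *: quot_pi v.
Proof. by rewrite -quot_scaleE. Qed.

End QuotientModule.

Section QuotientMap.
Variables (A : pzRingType) (V W : lmodType A) (P : V -> Prop) (Q : W -> Prop).
Hypotheses (P_submod : submod_prop P) (Q_submod : submod_prop Q).
Variable f : {linear V -> W}.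

(** Again the proof is kept in the term. Its right-to-left implication makes the map well defined,
    the other one makes it injective. *)
Definition quot_map of (forall v, Q (f v) <-> P v) := fun (x : quot_mod P_submod) =>
  quot_pi Q_submod (f (repr x)).

Hypothesis f_kernel : forall v, Q (f v) <-> P v.
Local Notation qmap := (quot_map f_kernel).

Lemma quot_mapE v : qmap (quot_pi P_submod v) = quot_pi Q_submod (f v).
Proof.
have : repr (quot_pi P_submod v) - v \in submod_pred P_submod.
  by rewrite -quot_pi_eq quot_piK.
move=> /asboolP Pv; apply/eqP; rewrite quot_pi_eq -linearB.
exact/asboolP/f_kernel.
Qed.
Lemma quot_map_is_linear : linear qmap.
Proof.
move=> a x y; rewrite -[x]quot_piK -[y]quot_piK -quot_piZ -quot_piD !quot_mapE.
by rewrite -quot_piZ -quot_piD linearP.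
Qed.
HB.instance Definition _ :=
  GRing.isLinear.Build A (quot_mod P_submod) (quot_mod Q_submod) _
    qmap quot_map_is_linear.

Lemma quot_map_inj : injective qmap.
Proof.
apply: raddf_inj => x; rewrite -[x]quot_piK => fx0; apply/quot_pi_eq0/f_kernel.
by apply/(quot_pi_eq0 Q_submod); rewrite -quot_mapE.
Qed.

End QuotientMap.

(** * Colon ideals and Richman's criterion for flat overrings *)

Section Colon.
Variables (F : fieldType) (A : subring F).
Implicit Types (M N P Q : set F) (T : overring A) (x : F).

(** The ideal (M :_A x). For flat [T], membership of [x] in MT is tested below by whether this ideal
    generates the unit ideal of [T]. *)
Definition colon M x : set F := [set e | A e /\ M (e * x)].

Lemma submodule_ring (B : subring F) : A `<=` B -> submodule A B.
Proof.
by move=> AB; split; [exact: subring0|exact: subringD|move=> a x /AB; apply: subringM].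
Qed.

Lemma colon_ideal M x : submodule A M -> ideal A (colon M x).
Proof.
move=> [M0 MD MZ]; split; first by move=> e [].
split=> [|e e' [Ae Me] [Ae' Me']|a e Aa [Ae Me]].
- by split; [exact: subring0|rewrite mul0r].
- by split; [exact: subringD|rewrite mulrDl; apply: MD].
- by split; [exact: subringM|rewrite -mulrA; apply: MZ].
Qed.

Section Richman.
Variables (T : overring A) (x : F).
Hypothesis Tx : T x.

Let P (u : (ring_sort A)^o) := A (val (u : ring_sort A) * x).
Let Q (b : ring_sort A) (v : (ring_sort A)^o) := exists w, v = w * b.
Let L (t : overring_mod T) := mulset (colon A x) T (val t).

Local Lemma colon_submod : submod_prop P.
Proof.
split=> [|u v Pu Pv|a u Pu]; rewrite /P /=.
- by rewrite mul0r; apply: subring0.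
- by rewrite mulrDl; apply: subringD.
- by rewrite -mulrA; apply: subringM => //; apply: ring_sortP.
Qed.
Local Lemma multiples_submod b : submod_prop (Q b).
Proof.
split=> [|u v [w ->] [z ->]|a u [w ->]].
- by exists 0; rewrite mul0r.
- by exists (w + z); rewrite mulrDl.
- by exists (a * w); rewrite -mulrA.
Qed.
Local Lemma colon_ext_submod : submod_prop L.
Proof.
split=> [|u v Lu Lv|a u]; rewrite /L /=.
- exact: mulset0.
- exact: mulsetD.
- have : submodule A (mulset (colon A x) T).
    by apply: submodule_mul; have [] := colon_ideal x (submodule_ring (@subset_refl _ A)).
  by case=> _ _ LZ; apply: LZ; apply: ring_sortP.
Qed.

(** The pairing T x A/(A : x) -> T/(A : x)T, (t, [u]) |-> [ut]. It takes (1, [1]) to [1], so it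
    detects whether 1 lies in (A : x)T. *)
Let bil (t : overring_mod T) (y : quot_mod colon_submod) : quot_mod colon_ext_submod :=
  quot_pi colon_ext_submod ((repr y : ring_sort A) *: t).

Local Lemma bilE t (u : (ring_sort A)^o) :
  bil t (quot_pi colon_submod u) = quot_pi colon_ext_submod ((u : ring_sort A) *: t).
Proof.
set r : (ring_sort A)^o := repr (quot_pi colon_submod u).
apply/eqP; rewrite quot_pi_eq -scalerBl; apply/asboolP; apply: mem_mulset.
  have : r - u \in submod_pred colon_submod by rewrite -quot_pi_eq quot_piK.
  by move=> /asboolP; split=> //; apply: ring_sortP.
exact: ring_sortP.
Qed.

Local Lemma bil_bilinear : Defs.bilinear bil.
Proof.
split=> [t t' y|t y y'|a t y|a t y].
- by rewrite -[y]quot_piK !bilE scalerDr; apply: quot_piD.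
- by rewrite -[y]quot_piK -[y']quot_piK -quot_piD !bilE scalerDl; apply: quot_piD.
- rewrite -[y]quot_piK !bilE -quot_piZ !scalerA; congr quot_pi.
  by rewrite [a * _]mulrC.
- by rewrite -[y]quot_piK -quot_piZ !bilE -quot_piZ scalerA.
Qed.

(* With [x = a / b], multiplication by [a] induces an injection
   [A / (A : x) -> A / bA]; it becomes zero on [1] after tensoring with [T], since
   [1 (x) a = a (x) 1 = x (x) b]. *)
Lemma flat_colon : flat (overring_mod T) -> mulset (colon A x) T 1.
Proof.
move=> Tflat; have [a0 [b0 [Aa Ab b_neq0 xE]]] := overring_frac Tx.
pose a := RingSort Aa; pose b := RingSort Ab.
pose f : {linear (ring_sort A)^o -> (ring_sort A)^o} := a \*: idfun.
have fP u : Q b (f u) <-> P u.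
  rewrite /P xE /= mulrA -[val u * a0]mulrC; split=> [[w /(congr1 val)/= ua]|Pu].
    by rewrite ua mulfK //; apply: ring_sortP.
  by exists (RingSort Pu); apply: val_inj; rewrite /= mulfVK.
pose g : {linear quot_mod colon_submod -> quot_mod (multiples_submod b)} :=
  quot_map (multiples_submod b) fP.
have g_inj : injective g by apply: quot_map_inj.
have gE : g (quot_pi _ 1) = quot_pi _ (f 1) :=
  quot_mapE colon_submod (multiples_submod b) fP 1.
pose one : overring_mod T := RingSort (subring1 T).
have := Tflat _ _ g g_inj [:: (one, quot_pi colon_submod 1)] _ _ _ bil_bilinear.
rewrite big_seq1 /= bilE scale1r => /(_ _)/quot_pi_eq0; apply.
move=> N h [hD1 hD2 hZ1 hZ2]; rewrite big_seq1 /= gE.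
have h0 t : h t 0 = 0 by apply: (addIr (h t 0)); rewrite -hD2 !add0r.
rewrite quot_piZ hZ2 -hZ1.
have -> : a *: one = b *: (RingSort Tx : overring_mod T).
  by apply: val_inj; rewrite /= xE mulr1 mulrCA divff // mulr1.
rewrite hZ1 -hZ2 -quot_piZ (_ : quot_pi _ _ = 0) ?h0 //.
by apply/quot_pi_eq0; exists 1; rewrite mul1r -[LHS]/(b * 1) mulr1.
Qed.

End Richman.
End Colon.

(** Classical equality on overrings lets finite subfamilies of [Theta] be enumerated by
    sequences. *)
HB.instance Definition _ (F : fieldType) (A : subring F) := gen_eqMixin (overring A).

(** * Local-global principles for flat overrings and Jaffard families *)

Section Localization.
Variables (F : fieldType) (A : subring F).
Implicit Types (M N P Q : set F) (T S : overring A) (x : F).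

Lemma submodule_over (B : subring F) M : A `<=` B -> submodule B M -> submodule A M.
Proof. by move=> AB [M0 MD MZ]; split=> // a x /AB; apply: MZ. Qed.

Lemma submodule_setI M N :
  submodule A M -> submodule A N -> submodule A (M `&` N).
Proof.
move=> [M0 MD MZ] [N0 ND NZ]; split=> //.
  by move=> x y [Mx Nx] [My Ny]; split; [apply: MD|apply: ND].
by move=> a x Aa [Mx Nx]; split; [apply: MZ|apply: NZ].
Qed.

Lemma submodule_bigcap I (E : set I) (M : I -> set F) :
  (forall i, E i -> submodule A (M i)) -> submodule A (\bigcap_(i in E) M i).
Proof.
move=> Msub; split=> [i /Msub[]//|x y Mx My i Ei|a x Aa Mx i Ei].
  by have [_ MD _] := Msub i Ei; apply: MD; [apply: Mx|apply: My].
by have [_ _ MZ] := Msub i Ei; apply: MZ => //; apply: Mx.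
Qed.

(** Serves to impose two conditions at once: when [P] and [Q] both generate the unit ideal of [B],
    so do the products, which satisfy both conditions. *)
Lemma mulset_one (B : subring F) P Q :
  mulset P B 1 -> mulset Q B 1 -> mulset (mulset P Q) B 1.
Proof.
move=> P1 Q1; have := mem_mulset P1 Q1.
by rewrite mulr1 mulsetACA (@mulset_id _ B B).
Qed.

Lemma mulset_colonP M T x : mulset (colon A M x) T 1 -> mulset M T x.
Proof.
suff: mulset (colon A M x) T `<=` [set y | mulset M T (y * x)].
  by move=> sub /sub /=; rewrite mul1r.
apply: mulset_min => /= [|y z My Mz|e t [Ae Me] Tt].
- by rewrite mul0r; apply: mulset0.
- by rewrite mulrDl; apply: mulsetD.
- by rewrite mulrAC; apply: mem_mulset.
Qed.

(** For a product mt, (A : t) is contained in (M : mt) and generates the unit ideal of [T] by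
    flatness. For a sum, (M : y)(M : z) is contained in (M : y + z). *)
Lemma mulset_colon M T x :
  flat (overring_mod T) -> submodule A M -> mulset M T x -> mulset (colon A M x) T 1.
Proof.
move=> Tflat [M0 MD MZ].
suff sub : mulset M T `<=` [set y | mulset (colon A M y) T 1] by move/sub.
apply: mulset_min => /= [|y z cy cz|m t Mm Tt].
- rewrite -[1]mulr1; apply: mem_mulset; last exact: subring1.
  by split; [exact: subring1|rewrite mulr0].
- apply: mulsetS (mulset_one cy cz) => //; apply: mulset_min => /=.
  + by split; [exact: subring0|rewrite mul0r].
  + move=> a b [Aa Ma] [Ab Mb]; split; first exact: subringD.
    by rewrite mulrDl; apply: MD.
  + move=> a b [Aa May] [Ab Mbz]; split; first exact: subringM.
    have -> : a * b * (y + z) = b * (a * y) + a * (b * z) by ring.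
    by apply: MD; apply: MZ.
- apply: mulsetS (flat_colon Tt Tflat) => // e [Ae Aet]; split=> //.
  by rewrite mulrCA mulrC; apply: MZ.
Qed.

(** Flat extension commutes with finite intersections because (M : x)(N : x) is contained in (M [&]
    N : x). *)
Lemma mulset_setI M N T x : flat (overring_mod T) ->
  submodule A M -> submodule A N ->
  mulset M T x -> mulset N T x -> mulset (M `&` N) T x.
Proof.
move=> Tflat Msub Nsub Mx Nx; apply: mulset_colonP.
have [cM cN] := (mulset_colon Tflat Msub Mx, mulset_colon Tflat Nsub Nx).
apply: mulsetS (mulset_one cM cN) => //.
have [_ MNsub] := colon_ideal x (submodule_setI Msub Nsub).
have [c0 cD cZ] := MNsub; apply: mulset_min => // a b [Aa Ma] [Ab Nb].
have [[_ _ MZ] [_ _ NZ]] := (Msub, Nsub).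
split; first exact: subringM.
by split; [rewrite mulrAC mulrC; apply: MZ|rewrite -mulrA; apply: NZ].
Qed.

Variable Theta : set (overring A).
Hypothesis Theta_jaffard : jaffard_family Theta.

(** Completeness speaks of integral ideals only. It is applied to (M : x), which contains 1 as soon
    as all its extensions do. *)
Lemma jaffard_mem M x : submodule A M ->
  (forall T, Theta T -> mulset M T x) -> M x.
Proof.
have [Tflat _ Tcomplete _ _] := Theta_jaffard.
move=> Msub Mx; have [_ c1] : colon A M x 1.
  rewrite (Tcomplete _ (colon_ideal x Msub)) => T ThT.
  by apply: mulset_colon; [exact: Tflat| |exact: Mx].
by rewrite mul1r in c1.
Qed.

Lemma jaffard_eq M N : submodule A M -> submodule A N ->
  (forall T, Theta T -> mulset M T = mulset N T) -> M = N.
Proof.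
move=> Msub Nsub MN; apply/seteqP; split=> x Mx; apply: jaffard_mem => // T ThT.
  by rewrite -MN // -[x]mulr1; apply: mem_mulset => //; apply: subring1.
by rewrite MN // -[x]mulr1; apply: mem_mulset => //; apply: subring1.
Qed.

(* [T] and the intersection of the other members of [Theta] generate [K]. *)
Lemma jaffard_separation T d : Theta T -> A d -> d != 0 ->
  mulset [set a | A a /\ forall S, Theta S -> S <> T -> S (a / d)] T 1.
Proof.
have [Tflat _ _ Tind Tfin] := Theta_jaffard => ThT Ad d0.
have /finite_seqP[s sE] := Tfin d Ad d0.
(* Outside the finite list [s], [d] is a unit of [S] and the condition on [a] is automatic. The
   members of [s] are then treated one at a time. *)
suff: mulset [set a | A a /\ forall S, S \in s -> Theta S -> S <> T -> S (a / d)] T 1.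
  apply: mulsetS => // a [Aa aS]; split=> // S ThS ST.
  have [Ss|Ss] := boolP (S \in s); first exact: aS.
  apply: subringM; first exact: overring_sub.
  have nS : ~ (Theta S /\ ~ S d^-1).
    by move=> ?; move/negP: Ss; apply; change ([set` s] S); rewrite -sE.
  by apply: contrapT => nSd; apply: nS.
elim: s {sE} => [|S s IHs].
  rewrite -[1]mulr1; apply: mem_mulset; last exact: subring1.
  by split=> //; exact: subring1.
have [[ThS ST]|nS] := pselect (Theta S /\ S <> T); last first.
  apply: mulsetS IHs => // a [Aa aS]; split=> // S'; rewrite inE => /orP[/eqP->|].
    by move=> ThS ST; case: nS.
  exact: aS.
(* By independence ST = K contains 1/d, so the elements of [A] that multiply 1/d into [S] generate
   the unit ideal of [T]. *)
have cS : mulset (colon A S d^-1) T 1.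
  apply: mulset_colon; [exact: Tflat|exact/submodule_ring/overring_sub|].
  rewrite Tind //; apply: frac_ringV => //; exact: sub_frac.
apply: mulsetS (mulset_one cS IHs) => //; apply: mulset_min.
- split=> [|? _ _ _]; first exact: subring0.
  by rewrite mul0r; apply: subring0.
- move=> a b [Aa aS] [Ab bS]; split=> [|S' ? ? ?]; first exact: subringD.
  by rewrite mulrDl; apply: subringD; [apply: aS|apply: bS].
- move=> a b [Aa aS] [Ab bS]; split=> [|S']; first exact: subringM.
  rewrite inE => /orP[/eqP-> _ _|S's ThS' S'T].
    by rewrite mulrAC; apply: subringM => //; exact: overring_sub.
  by rewrite -mulrA; apply: subringM; [exact: overring_sub|exact: bS].
Qed.

(** The hypotheses say that each [M T] agrees with NT up to the factor [d]. Given [x] in [M T],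
    choose [e] with edx in [N], and [a] divisible by d^2 in every other member [S]; then eax lies in
    all the [M S], and such products ea generate the unit ideal of [T]. *)
Lemma jaffard_glue N (M : overring A -> set F) d : submodule A N -> A d -> d != 0 ->
  (forall T, Theta T -> submodule T (M T)) ->
  (forall T x, Theta T -> mulset N T x -> M T (d * x)) ->
  (forall T x, Theta T -> M T x -> mulset N T (d * x)) ->
  forall T, Theta T -> mulset (\bigcap_(S in Theta) M S) T = M T.
Proof.
have [Tflat _ _ _ _] := Theta_jaffard.
move=> Nsub Ad d0 Msub NM MN T ThT; apply/seteqP; split.
  have [M0 MD MZ] := Msub T ThT; apply: mulset_min => // x t Mx Tt.
  by rewrite mulrC; apply: MZ => //; apply: Mx.
move=> x Mx; apply: mulset_colonP.
have cap_sub : submodule A (\bigcap_(S in Theta) M S).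
  apply: submodule_bigcap => S ThS; apply: submodule_over (Msub S ThS).
  exact: overring_sub.
have cN := mulset_colon (Tflat T ThT) Nsub (MN T x ThT Mx).
(* One factor [d] brings [x] into NT, the other leads from NS back into [M S]. *)
have sep := jaffard_separation ThT (subringM Ad Ad) (mulf_neq0 d0 d0).
apply: mulsetS (mulset_one cN sep) => //.
have [_ [c0 cD cZ]] := colon_ideal x cap_sub.
apply: mulset_min => // e a [Ae Ne] [Aa aS]; split; first exact: subringM.
move=> S ThS; have [_ _ MZ] := Msub S ThS.
have [->|ST] := pselect (S = T).
  by have [_ _ MTZ] := Msub T ThT; apply: MTZ => //; apply/overring_sub/subringM.
have -> : e * a * x = a / (d * d) * (d * (e * (d * x))) by field.
apply: MZ; first exact: aS.
by apply: NM => //; rewrite -[_ * _]mulr1; apply: mem_mulset => //; apply: subring1.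
Qed.

(** Off the finite set [E] every element of [A] is admissible, so the product of one choice for each
    member of [E] works. *)
Lemma common_denominator (Q : overring A -> F -> Prop) (E : set (overring A)) :
  finite_set E -> (forall T, Theta T -> ~ E T -> Q T 1) ->
  (forall T a d, Theta T -> A a -> Q T d -> Q T (a * d)) ->
  (forall T, Theta T -> exists d, [/\ A d, d != 0 & Q T d]) ->
  exists d, [/\ A d, d != 0 & forall T, Theta T -> Q T d].
Proof.
move=> /finite_seqP[s ->] Q1 QM Qex.
suff [d [Ad d0 Qd]] : exists d,
    [/\ A d, d != 0 & forall T, T \in s -> Theta T -> Q T d].
  exists d; split=> // T ThT; have [Ts|/negP Ts] := boolP (T \in s); first exact: Qd.
  by rewrite -[d]mulr1; apply: QM => //; apply: Q1.
elim: s {Q1} => [|T s [d [Ad d0 Qd]]].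
  by exists 1; split; [exact: subring1|exact: oner_neq0|].
have [ThT|nT] := pselect (Theta T); last first.
  exists d; split=> // S; rewrite inE => /orP[/eqP->//|]; exact: Qd.
have [e [Ae e0 Qe]] := Qex T ThT.
exists (d * e); split; [exact: subringM|exact: mulf_neq0|].
move=> S; rewrite inE => /orP[/eqP-> _|Ss ThS]; first exact: QM.
by rewrite mulrC; apply: QM => //; apply: Qd.
Qed.

End Localization.

(** * Invertible ideals, extensions and denominators *)

Section Ideals.
Variable F : fieldType.
Implicit Types (A B : subring F) (I J M : set F) (x y : F).

Lemma span1_self A x : span1 A x x.
Proof. by exists 1; rewrite ?mulr1 //; exact: subring1. Qed.

Lemma span1_submodule A x : submodule A (span1 A x).
Proof.
rewrite -(span1_ext x (@subset_refl _ A)) mulsetC.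
by apply: submodule_mul; apply: submodule_ring.
Qed.

Lemma submodule_extr A I J : submodule A J -> submodule A (mulset I J).
Proof. by rewrite mulsetC => Jsub; apply: submodule_mul. Qed.

Lemma submodule_ext A I : submodule A (mulset I A).
Proof. by apply: submodule_extr; apply: submodule_ring. Qed.

Lemma mulset_ringr A I : submodule A I -> mulset I A = I.
Proof. by rewrite mulsetC; apply: mulset_ringl. Qed.

(** Since IA = I, extending an ideal of R to RT amounts to multiplying by T alone, which brings it
    under the lemmas on D-modules. *)
Lemma ext_mul_ring A B I : submodule A I -> mulset I (mul_ring A B) = mulset I B.
Proof.
by move=> Isub; rewrite -{2}(mulset_ringr Isub); apply: mulsetA.
Qed.

Lemma ext_mul_ringr A B I : submodule B I -> mulset I (mul_ring A B) = mulset I A.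
Proof. by move=> Isub; rewrite -{2}(mulset_ringr Isub) -mulsetA [mulset B A]mulsetC. Qed.

Lemma invertible_span1 A x : frac_ring A x -> x != 0 -> invertible A (span1 A x).
Proof.
have span_frac y : frac_ring A y -> fractional_ideal A (span1 A y).
  move=> Ky; have [a [b [Aa Ab b0 yE]]] := Ky; split; last 2 first.
  - exact: span1_submodule.
  - exists b; split=> // _ [c Ac <-]; rewrite yE mulrA [b * _]mulrC mulfVK //.
    exact: subringM.
  - by move=> _ [c Ac <-]; apply: subringM => //; apply: sub_frac.
move=> Kx x0; split; first exact: span_frac.
exists (span1 A x^-1); split; first exact/span_frac/frac_ringV.
by rewrite span1M divff // span11.
Qed.

Lemma invertible_submodule A I : invertible A I -> submodule A I.
Proof. by case=> [[]]. Qed.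

Lemma invertible_frac A I : invertible A I -> I `<=` frac_ring A.
Proof. by case=> [[]]. Qed.

Lemma frac_mid A B : A `<=` B -> B `<=` frac_ring A ->
  frac_ring B = frac_ring A :> set F.
Proof.
move=> AB BK; apply/seteqP; split; last exact: frac_mono.
move=> _ [a [b [/BK Ka /BK Kb b0 ->]]]; apply: subringM => //.
exact: frac_ringV.
Qed.

Lemma mulset_frac_eq A I : invertible A I -> mulset I (frac_ring A) = frac_ring A.
Proof.
move=> Iinv; have [J [Jinv IJ]] := invertible_inv Iinv.
have KM := @submodule_ring F (frac_ring A) (frac_ring A) (@subset_refl _ _).
have sub L : invertible A L -> mulset L (frac_ring A) `<=` frac_ring A.
  move=> /invertible_frac LK; have [K0 KD KZ] := KM; apply: mulset_min => // x y /LK.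
  exact: subringM.
apply/seteqP; split; first exact: sub.
rewrite -{1}(mulset_id (@sub_frac F A)) -IJ [mulset J I]mulsetC -mulsetA.
by apply: mulsetS => //; apply: sub.
Qed.

Lemma frac_den A M x : submodule A M -> mulset M (frac_ring A) x ->
  exists s, [/\ A s, s != 0 & M (s * x)].
Proof.
move=> [M0 MD MZ].
suff sub : mulset M (frac_ring A) `<=` [set y | exists s, [/\ A s, s != 0 & M (s * y)]].
  by move/sub.
apply: mulset_min => /=
  [|y z [s [As s0 Msy]] [t [At t0 Mtz]]|m _ Mm [a [b [Aa Ab b0 ->]]]].
- by exists 1; rewrite mulr0 oner_neq0; split=> //; exact: subring1.
- exists (s * t); split; [exact: subringM|exact: mulf_neq0|].
  have -> : s * t * (y + z) = t * (s * y) + s * (t * z) by ring.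
  by apply: MD; apply: MZ.
- exists b; split=> //; have -> : b * (m * (a / b)) = a * m by field.
  exact: MZ.
Qed.

Lemma inv_idealD B (I J : inv_ideal B) : val (I + J) = mulset (val I) (val J).
Proof. by []. Qed.

Lemma inv_idealN B (I : inv_ideal B) : mulset (val I) (val (- I)) = B.
Proof. by rewrite -inv_idealD subrr. Qed.

End Ideals.

(** * Additive maps into direct sums and out of quotient groups *)

Section AdditiveMaps.

Definition dsum_map (U : zmodType) (I : Type) (V : I -> zmodType)
    (f : forall i, {additive U -> V i})
    (f_fin : forall x, finite_set [set i | f i x != 0]) (x : U) : dsum V :=
  DSum (f_fin x).

Variables (U : zmodType) (I : Type) (V : I -> zmodType).
Variables (f : forall i, {additive U -> V i}).
Hypothesis f_fin : forall x, finite_set [set i | f i x != 0].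

Lemma dsum_map_is_zmod_morphism : zmod_morphism (dsum_map f_fin).
Proof. by move=> x y; apply: dsum_eq => i; apply: raddfB. Qed.
HB.instance Definition _ :=
  GRing.isZmodMorphism.Build U (dsum V) (dsum_map f_fin) dsum_map_is_zmod_morphism.

Variables (W : zmodType) (S : zmodClosed U) (g : {additive U -> W}).

Lemma quot_eq0 x : (\pi x == 0 :> Quotient.quot S) = (x \in S).
Proof. by rewrite -(raddf0 (\pi_(Quotient.quot S))) -Quotient.idealrBE subr0. Qed.

Definition quot_lift of (forall x, x \in S -> g x = 0) :=
  fun x : Quotient.quot S => g (repr x).

Hypothesis g_kill : forall x, x \in S -> g x = 0.

Lemma quot_liftE x : quot_lift g_kill (\pi x) = g x.
Proof.
apply/eqP; rewrite -subr_eq0 /quot_lift -raddfB; apply/eqP/g_kill.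
by rewrite Quotient.idealrBE reprK.
Qed.
Lemma quot_lift_is_zmod_morphism : zmod_morphism (quot_lift g_kill).
Proof.
move=> x y; rewrite -[x]reprK -[y]reprK -(raddfB (\pi_(Quotient.quot S))) !quot_liftE.
exact: raddfB.
Qed.
HB.instance Definition _ :=
  GRing.isZmodMorphism.Build (Quotient.quot S) W (quot_lift g_kill)
    quot_lift_is_zmod_morphism.

End AdditiveMaps.

Lemma bijective_of_inj_surj (T U : Type) (f : T -> U) :
  injective f -> (forall y, exists x, f x = y) -> bijective f.
Proof.
by move=> f_inj /choice[g fgK]; exists g => // x; apply: f_inj; rewrite fgK.
Qed.

Lemma pic_ext_trans (F : fieldType) (A B C : subring F) (AC : A `<=` C)
    (BC : B `<=` C) (AB : A `<=` B) (x : Pic A) :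
  pic_ext BC (pic_ext AB x) = pic_ext AC x.
Proof.
rewrite -[x]reprE !pic_extE; congr cls; apply: val_inj.
rewrite -[LHS]/(mulset (mulset (val (repr x)) B) C) -mulsetA mulset_id //.
Qed.

Lemma mem_pic_theta (F : fieldType) (A : subring F) (Theta : set (overring A)) v :
  v \in pic_theta_pred Theta <->
  forall T, Theta T -> pic_ext (@overring_sub _ _ T) v = 0.
Proof.
split=> [/asboolP[I [-> pI]] T ThT|v0]; last first.
  apply/asboolP; exists (repr v); rewrite reprE; split=> // T ThT.
  have := v0 T ThT; rewrite -[v]reprE pic_extE reprE -(@cls0 _ T) => /clsP.
  by rewrite subr0.
by rewrite pic_extE -(@cls0 _ T); apply/clsP; rewrite subr0; apply: pI.
Qed.

(** * Pseudo-polynomial extensions: units of RK and contraction to K *)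

Section PseudoPolynomial.
Variables (F : fieldType) (D R : subring F).
Implicit Types (A B : subring F) (I J : set F) (T : overring D).
Local Notation K := (frac_ring D).
Local Notation RK := (mul_ring R K).
Hypothesis DR : D `<=` R.
Hypothesis frac_R : forall x, frac_ring R x.
(* The consequence [IR `&` K = I] of the retraction [R -> D]. *)
Hypothesis contraction : forall I, submodule D I -> I `<=` K ->
  mulset I R `&` K `<=` I.
Hypothesis pseudo : pseudo_polynomial D R.
Hypothesis Pic_RK : forall x : Pic RK, x = 0.

Lemma contraction_ring A x : D `<=` A -> A `<=` K -> mulset A R x -> K x -> A x.
Proof. by move=> DA AK Ax Kx; apply: (contraction (submodule_ring DA) AK). Qed.

(** Clear denominators so that sy and t/y lie in [R]. The ideal (sy)R contains st, so it is unitary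
    and has a generator [e] in [D]; then q = e/s. *)
Lemma unit_span1 y : RK y -> RK y^-1 -> y != 0 ->
  exists q, [/\ K q, q != 0 & span1 R y = span1 R q].
Proof.
have Rsub := submodule_ring DR.
move=> /(frac_den Rsub)[s [Ds s0 Rsy]] /(frac_den Rsub)[t [Dt t0 Rty]] y0.
have [|e De Ee] := pseudo Rsy.
  exists (s * t); first exact: mulf_neq0.
  split; last by apply/sub_frac/subringM.
  by exists (t * y^-1) => //; field.
have Ey : span1 R y = span1 R (e / s).
  by rewrite [e / s]mulrC -span1M -Ee span1M mulKf.
exists (e / s); split=> //; first by exists e, s.
apply: contraNneq y0 => q0; have := span1_self R y.
by rewrite Ey q0 => -[r _ <-]; rewrite mul0r.
Qed.

Lemma span1_RK y : span1 RK y = RK -> y != 0 -> RK y /\ RK y^-1.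
Proof.
move=> yRK y0; split; first by rewrite -yRK; apply: span1_self.
have := subring1 RK; rewrite -{1}yRK => -[z RKz /(canRL (mulKf y0))].
by rewrite mulr1 => <-.
Qed.

Lemma unit_span1_over B y : R `<=` B -> span1 RK y = RK -> y != 0 ->
  exists q, [/\ K q, q != 0 & span1 B y = span1 B q].
Proof.
move=> RB yRK y0; have [RKy RKy'] := span1_RK yRK y0.
have [q [Kq q0 Eq]] := unit_span1 RKy RKy' y0.
by exists q; split=> //; rewrite -(span1_ext y RB) Eq span1_ext.
Qed.

Lemma frac_over B x : R `<=` B -> frac_ring B x.
Proof. by move=> RB; apply: frac_mono RB _ _. Qed.

Lemma mulset_extK A I : D `<=` A -> A `<=` K -> invertible A I ->
  mulset (mulset I R) K = RK.
Proof.
move=> DA AK /mulset_frac_eq; rewrite (frac_mid DA AK) => IK.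
by rewrite -mulsetA [mulset R K]mulsetC mulsetA IK mulsetC.
Qed.

(** Both IR and RA extend to RK, so [y] is a unit of RK and may be replaced by some [q] of K.
    Contracting IR = qRA to K then leaves I = qA. *)
Lemma principal_contraction A I y : D `<=` A -> A `<=` K -> invertible A I ->
  y != 0 -> mulset I R = span1 (mul_ring R A) y -> principal A I.
Proof.
move=> DA AK Iinv y0 IR.
have RRA := @sub_mull F R A.
have RARK : mul_ring R A `<=` RK by apply: mulsetS.
have AE : frac_ring A = K :> set F by apply: frac_mid.
have yRK : span1 RK y = RK.
  rewrite -(span1_ext y RARK) -IR ext_mul_ring; last exact: submodule_ext.
  exact: mulset_extK Iinv.
have [q [Kq q0 Eq]] := unit_span1_over RRA yRK y0.
exists q; split=> //; first by rewrite AE.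
have [I0 ID IZ] := invertible_submodule Iinv.
have IDsub := submodule_over DA (invertible_submodule Iinv).
have IK : I `<=` K by move=> x /(invertible_frac Iinv); rewrite AE.
apply/seteqP; split=> [x Ix|_ [a Aa <-]].
  have : mulset I R x by rewrite -[x]mulr1; apply: mem_mulset => //; exact: subring1.
  rewrite IR Eq => -[r RAr xE]; exists r => //.
  apply: contraction_ring => //; first by rewrite mulsetC.
  by rewrite -(mulKf q0 r) xE; apply: subringM; [exact: frac_ringV|exact: IK].
rewrite mulrC; apply: IZ => //; apply: contraction => //; split=> //.
by rewrite IR Eq; apply: span1_self.
Qed.

(** * Representatives that become trivial over RK *)

Section Normalize.
Variables (B : subring F) (RB : R `<=` B) (BRK : B `<=` RK).

(** Divide any representative by a generator [y] of its extension to RK; this keeps the class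
    because [y] lies in the quotient field of [B]. *)
Lemma pic_normalize (z : Pic B) :
  exists J : inv_ideal B, cls J = z /\ mulset (val J) RK = RK.
Proof.
have : cls (inv_ext BRK (repr z)) = cls 0 by rewrite [LHS]Pic_RK [RHS]Pic_RK.
move=> /clsP; rewrite subr0 => -[y [_ y0 Ey]].
rewrite -[LHS]/(mulset (val (repr z)) RK) in Ey.
have By := frac_over y^-1 RB.
pose J := repr z + InvIdeal (invertible_span1 By (invr_neq0 y0)).
exists J; split.
  rewrite -[RHS]reprE; apply/clsP; rewrite addrAC subrr add0r /=.
  by exists y^-1; split=> //; apply: invr_neq0.
rewrite -[LHS]/(mulset (mulset (val (repr z)) (span1 B y^-1)) RK).
rewrite -{1}(mulset_id (@subset_refl _ RK)) mulsetACA Ey span1_ext //.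
by rewrite span1M divff // span11.
Qed.

Lemma normalized_inv I J : mulset I J = B -> submodule B J -> mulset I RK = RK ->
  mulset J RK = RK.
Proof.
move=> IJ Jsub IRK; rewrite -[RHS](mulset_id BRK) -IJ [mulset I J]mulsetC -mulsetA.
by rewrite IRK.
Qed.

Lemma normalized_mem J : submodule B J -> mulset J RK = RK ->
  exists s, [/\ D s, s != 0 & J s].
Proof.
move=> Jsub JRK; have : mulset J K 1.
  by rewrite -(ext_mul_ring K (submodule_over RB Jsub)) JRK; apply: subring1.
have DB : D `<=` B by move=> x /DR/RB.
by move=> /(frac_den (submodule_over DB Jsub))[s]; rewrite mulr1; exists s.
Qed.

(* [s] in [J] and [t] in [J^-1] give the common denominator [s * t]. *)
Lemma normalized_den I J : submodule B I -> submodule B J -> mulset I J = B ->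
  mulset I RK = RK -> exists d, [/\ D d, d != 0, I d & J d].
Proof.
move=> Isub Jsub IJ IRK.
have [s [Ds s0 Is]] := normalized_mem Isub IRK.
have [t [Dt t0 Jt]] := normalized_mem Jsub (normalized_inv IJ Jsub IRK).
exists (s * t); split; [exact: subringM|exact: mulf_neq0| |].
  by rewrite mulrC; have [_ _ IZ] := Isub; apply: IZ => //; apply/RB/DR.
by have [_ _ JZ] := Jsub; apply: JZ => //; apply/RB/DR.
Qed.

End Normalize.

(** * Descent from R to D, and gluing along the Jaffard family *)

Section Descent.
Variable Theta : set (overring D).
Hypothesis Theta_jaffard : jaffard_family Theta.

Lemma overring_sub_RK T : mul_ring R T `<=` RK.
Proof. by apply: mulsetS => //; apply: overring_frac. Qed.

Lemma pic_ext_support (x : Pic R) : exists d, [/\ D d, d != 0 &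
  forall T, T d^-1 -> pic_ext (@sub_mull _ R T) x = 0].
Proof.
have [J [<- JRK]] := pic_normalize (@subset_refl _ R) (@sub_mull _ R K) x.
have [d [Dd d0 Jd J'd]] := normalized_den (@subset_refl _ R) (@sub_mull _ R K)
  (inv_submodule J) (inv_submodule _) (inv_idealN J) JRK.
exists d; split=> // T Td; rewrite pic_extE -(@cls0 _ (mul_ring R T)).
congr cls; apply: val_inj.
rewrite -[LHS]/(mulset (val J) (mul_ring R T)) ext_mul_ring; last exact: inv_submodule.
apply/seteqP; split=> [|y RTy].
  apply: mulset_min; [exact: mulset0|exact: mulsetD|] => j t Jj Tt.
  have -> : j * t = (d * j) * (d^-1 * t) by field.
  apply: mem_mulset; last exact: subringM.
  by rewrite -(inv_idealN J) mulsetC; apply: mem_mulset.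
have : mulset R T y by [].
apply: mulset_min => {y RTy}; [exact: mulset0|exact: mulsetD|] => r t Rr Tt.
have -> : r * t = (r * d) * (d^-1 * t) by field.
apply: mem_mulset; last exact: subringM.
by have [_ _] := inv_submodule J; apply.
Qed.

Lemma pic_ext_finite (x : Pic R) :
  finite_set [set T : Theta | pic_ext (@sub_mull _ R (val T)) x != 0].
Proof.
have [_ _ _ _ Tfin] := Theta_jaffard.
have [d [Dd d0 xT]] := pic_ext_support x.
pose f (T : Theta) := val T.
apply: (@sub_finite_set _ _ (f @^-1` [set T | Theta T /\ ~ T d^-1])).
  move=> T /= /eqP xT0; split; first exact: set_mem (valP T).
  by move=> /xT.
apply: finite_preimage; last exact: Tfin.
by move=> S T _ _; apply: val_inj.
Qed.

(** Over RK both [J] and [I] become trivial, so [y] is a unit there and generates the same ideal as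
    some [q] of K. The descended ideal is qI. *)
Lemma local_descent T J I y : submodule R J -> mulset J RK = RK -> invertible T I ->
  y != 0 ->
  mulset J (mul_ring R T) = mulset (span1 (mul_ring R T) y) (mulset I (mul_ring R T)) ->
  exists I', invertible T I' /\ mulset J T = mulset I' R.
Proof.
move=> Jsub JRK Iinv y0 JE.
have RTRK := @overring_sub_RK T; have TRT := @sub_mulr _ R T.
have [DT TK] := (@overring_sub _ _ T, @overring_frac _ _ T).
have IRK : mulset (mulset I (mul_ring R T)) RK = RK.
  rewrite (ext_mul_ringr R (invertible_submodule Iinv)).
  rewrite (ext_mul_ring K (submodule_ext R I)).
  exact: mulset_extK Iinv.
have yRK : span1 RK y = RK.
  by rewrite -(span1_ext y RTRK) -[in LHS]IRK mulsetA -JE -mulsetA (mulset_id RTRK).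
have [q [Kq q0 Eq]] := unit_span1_over (@sub_mull _ R T) yRK y0.
exists (mulset (span1 T q) I); split.
  by apply: invertible_mul => //; apply: invertible_span1 => //; rewrite (frac_mid DT TK).
rewrite -(ext_mul_ringr R (submodule_mul I (span1_submodule T q))).
rewrite -(ext_mul_ring T Jsub) JE Eq -(span1_ext q TRT) mulsetACA.
by rewrite (mulset_id (@subset_refl _ (mul_ring R T))).
Qed.

(** By flatness (J [&] K)T is the intersection of JT = IR with K, which is [I] by contraction. *)
Lemma contract_local T J I : Theta T -> submodule R J -> invertible T I ->
  mulset J T = mulset I R -> mulset (J `&` K) T = I.
Proof.
move=> ThT Jsub Iinv JT; have [Tflat _ _ _ _] := Theta_jaffard.
have [DT TK] := (@overring_sub _ _ T, @overring_frac _ _ T).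
have IK : I `<=` K by rewrite -(frac_mid DT TK); apply: invertible_frac.
have IDsub := submodule_over DT (invertible_submodule Iinv).
apply/seteqP; split=> [|x Ix].
  apply: mulset_min => [||x t [Jx Kx] Tt]; do ?by case: IDsub.
  apply: contraction => //; split; first by rewrite -JT; apply: mem_mulset.
  by apply: subringM => //; apply: TK.
apply: mulset_setI; first exact: Tflat.
- exact: submodule_over Jsub.
- exact/submodule_ring/sub_frac.
- by rewrite JT -[x]mulr1; apply: mem_mulset => //; apply: subring1.
- by rewrite -[x]mulr1; apply: mem_mulset; [exact: IK|exact: subring1].
Qed.

(** Write RT as (IR)(I'R) = (JT)(I'R) and multiply by [J'], which cancels [J]. *)
Lemma inverse_local T I J I' J' : mulset J J' = R -> submodule R J' -> mulset I I' = T ->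
  submodule T I' -> mulset J T = mulset I R -> mulset J' T = mulset I' R.
Proof.
move=> JJ' J'sub II' I'sub JT.
have E : mulset (mulset I R) (mulset I' R) = mul_ring R T.
  by rewrite mulsetACA II' mulset_id // mulsetC.
rewrite -(ext_mul_ring T J'sub) -E -JT [mulset I' R]mulsetC !mulsetA (mulsetC J') JJ'.
rewrite [mulset (mulset R T) R]mulsetC mulsetA (mulset_id (@subset_refl _ R)).
by rewrite -mulsetA (mulset_ringl I'sub).
Qed.

(** The ideal is J [&] K, with inverse J' [&] K. That their product is [D] and that J [&] K
    generates [J] are equalities of D-modules, so they are checked in each [T]. *)
Lemma ideal_descent J : invertible R J -> mulset J RK = RK ->
  (forall T, Theta T -> exists I, invertible T I /\ mulset J T = mulset I R) ->
  exists I, invertible D I /\ mulset I R = J.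
Proof.
move=> Jinv JRK Jloc; have Jsub := invertible_submodule Jinv.
have [J' [J'inv J'J]] := invertible_inv Jinv; have J'sub := invertible_submodule J'inv.
have JJ' : mulset J J' = R by rewrite mulsetC.
have JDsub := submodule_over DR Jsub; have J'Dsub := submodule_over DR J'sub.
have KDsub := submodule_ring (@sub_frac _ D).
have [d [Dd d0 Jd J'd]] := normalized_den (@subset_refl _ R) (@sub_mull _ R K)
  Jsub J'sub JJ' JRK.
have frac_cap L L' : submodule D L -> mulset L L' = R -> L' d ->
    fractional_ideal D (L `&` K).
  move=> Lsub LL' L'd; split; [by move=> x []|exact: submodule_setI|].
  (* For [x] in L [&] K, dx lies in LL' = R and in K, hence in [D]. *)
  exists d; split=> // x [Lx Kx]; apply: contraction_ring => //; first exact: sub_frac.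
    rewrite mulset_id // -LL' mulrC; exact: mem_mulset.
  by apply: subringM => //; apply: sub_frac.
have fI := frac_cap _ _ JDsub JJ' J'd.
have fI' := frac_cap _ _ J'Dsub J'J Jd.
have [[_ Isub _] [_ I'sub _]] := (fI, fI').
exists (J `&` K); split.
  split=> //; exists (J' `&` K); split=> //.
  apply: (jaffard_eq Theta_jaffard) => [||T ThT].
  - exact: submodule_mul.
  - exact: submodule_ring.
  have [I [Iinv JT]] := Jloc T ThT.
  have [I' [I'inv I'I]] := invertible_inv Iinv.
  have II' : mulset I I' = T by rewrite mulsetC.
  have J'T := inverse_local JJ' J'sub II' (invertible_submodule I'inv) JT.
  rewrite -{1}(mulset_id (@subset_refl _ T)) mulsetACA (contract_local ThT Jsub Iinv JT).
  rewrite (contract_local ThT J'sub I'inv J'T) II' mulset_id //; exact: overring_sub.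
apply: (jaffard_eq Theta_jaffard) => // [|T ThT]; first exact: submodule_mul.
have [I [Iinv JT]] := Jloc T ThT.
by rewrite -mulsetA [mulset R T]mulsetC mulsetA (contract_local ThT Jsub Iinv JT).
Qed.

(** The kernel of [pi_Theta] is the case where every [w] is 0; arbitrary [w] give the injectivity
    between the [LPic]. *)
Lemma pic_descent (x : Pic R) :
  (forall T, Theta T ->
     exists w, pic_ext (@sub_mulr _ R T) w = pic_ext (@sub_mull _ R T) x) ->
  exists v, pic_ext DR v = x.
Proof.
have [J [<- JRK]] := pic_normalize (@subset_refl _ R) (@sub_mull _ R K) x => xT.
have [|I [Iinv IR]] := ideal_descent (inv_idealP J) JRK.
  move=> T ThT; have [w] := xT T ThT; rewrite -[w]reprE !pic_extE => /esym/clsP.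
  set JT := inv_ext _ _; set IT := inv_ext _ _ => -[y [_ y0 Ey]].
  apply: (local_descent (inv_submodule J) JRK (inv_idealP (repr w)) y0).
  by rewrite -Ey -[RHS](inv_idealD (JT - IT) IT) addrNK.
exists (cls (InvIdeal Iinv)); rewrite pic_extE; congr cls; exact: val_inj.
Qed.

Lemma pic_gluing (z : forall T : Theta, Pic (mul_ring R (val T))) :
  finite_set [set T | z T != 0] ->
  exists x, forall T : Theta, pic_ext (@sub_mull _ R (val T)) x = z T.
Proof.
move=> zfin.
(* A representative is picked for every overring, 0 being the default outside [Theta]. Where the
   class vanishes it is RT itself, so that 1 is a denominator there. *)
have local T : exists J : inv_ideal (mul_ring R T), mulset (val J) RK = RK /\
    forall h : T \in Theta, cls J = z (exist _ T h) /\
      (z (exist _ T h) = 0 -> J = 0).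
  have [h|nh] := pselect (T \in Theta); last first.
    by exists 0; split=> [|/nh//]; apply: mulset_id (@overring_sub_RK T).
  have irr (h' : T \in Theta) : h' = h by apply: bool_irrelevance.
  have [z0|z0] := pselect (z (exist _ T h) = 0).
    exists 0; split=> [|h']; first exact: mulset_id (@overring_sub_RK T).
    by rewrite (irr h') z0 cls0.
  have [J [Jz JRK]] :=
    pic_normalize (@sub_mull _ R T) (@overring_sub_RK T) (z (exist _ T h)).
  by exists J; split=> // h'; rewrite (irr h').
pose J T := projT1 (cid (local T)).
have JRK T : mulset (val (J T)) RK = RK by case: (projT2 (cid (local T))).
have Jz (T : Theta) : cls (J (val T)) = z T.
  case: T => T h /=; by case: (projT2 (cid (local T))) => _ /(_ h) [].
have J0 (T : Theta) : z T = 0 -> J (val T) = 0.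
  case: T => T h /=; by case: (projT2 (cid (local T))) => _ /(_ h) [].
have JJ' T := inv_idealN (J T).
have Efin : finite_set ((val : Theta -> overring D) @` [set T | z T != 0]).
  exact: finite_image.
have DRT T : D `<=` mul_ring R T by move=> a /DR; apply: sub_mull.
(* As [d] lies in each [J T] and in its inverse, dRT is inside [J T] and d(J T) inside RT, as
   [jaffard_glue] requires for N = R. *)
have [d [Dd d0 Jd]] : exists d, [/\ D d, d != 0 &
    forall T, Theta T -> val (J T) d /\ val (- J T) d].
  apply: common_denominator Efin _ _ _.
  - move=> T /mem_set h nE; have JT0 : J T = 0.
      apply: (J0 (exist _ T h)).
      by apply: contrapT => /eqP zT; apply: nE; exists (exist _ T h).
    by rewrite JT0 oppr0; split; apply: subring1.
  - move=> T a e ThT Da [Je J'e].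
    have [[_ _ JZ] [_ _ J'Z]] := (inv_submodule (J T), inv_submodule (- J T)).
    by split; [apply: JZ|apply: J'Z] => //; apply: DRT.
  - move=> T ThT.
    have [e [De e0 Je J'e]] := normalized_den (@sub_mull _ R T) (@overring_sub_RK T)
      (inv_submodule (J T)) (inv_submodule _) (JJ' T) (JRK T).
    by exists e; split.
have RDsub := submodule_ring DR.
(* Stated for a pair of mutually inverse families, to be applied to [J] and to its inverse. *)
have glue (L L' : forall T, inv_ideal (mul_ring R T)) :
    (forall T, mulset (val (L T)) (val (L' T)) = mul_ring R T) ->
    (forall T, Theta T -> val (L T) d /\ val (L' T) d) ->
    forall T, Theta T -> mulset (\bigcap_(S in Theta) val (L S)) T = val (L T).
  move=> LL' Ld; apply: (jaffard_glue Theta_jaffard RDsub Dd d0) => T.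
  - by move=> _; apply: submodule_over (inv_submodule (L T)); apply: sub_mulr.
  - move=> y ThT RTy; rewrite mulrC; have [_ _] := inv_submodule (L T); apply=> //.
    by have [] := Ld T ThT.
  - move=> y ThT Ly; rewrite -[mulset R T]/(carrier (mul_ring R T)) -LL' mulrC.
    by apply: mem_mulset => //; have [] := Ld T ThT.
pose X := \bigcap_(S in Theta) val (J S); pose X' := \bigcap_(S in Theta) val (- J S).
have XT T : Theta T -> mulset X T = val (J T) := glue _ (fun T => - J T) JJ' Jd T.
have X'T T : Theta T -> mulset X' T = val (- J T).
  apply: (glue (fun T => - J T) J) => S; first by rewrite mulsetC.
  by move=> /Jd[].
have cap_sub (L : forall T, inv_ideal (mul_ring R T)) :
    submodule R (\bigcap_(S in Theta) val (L S)).
  apply: submodule_bigcap => S _; apply: submodule_over (inv_submodule (L S)).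
  exact: sub_mull.
have frac_cap (L L' : forall T, inv_ideal (mul_ring R T)) :
    (forall T, mulset (val (L T)) (val (L' T)) = mul_ring R T) ->
    (forall T, Theta T -> val (L' T) d) ->
    fractional_ideal R (\bigcap_(S in Theta) val (L S)).
  move=> LL' L'd; split; [by move=> x _; apply: frac_R|exact: cap_sub|].
  (* In each [T], dx lies in (L T)(L' T) = RT, hence dx lies in [R]. *)
  exists d; split=> //; first exact: DR.
  move=> x Lx; apply: (jaffard_mem Theta_jaffard RDsub) => T ThT.
  rewrite -[mulset R T]/(carrier (mul_ring R T)) -LL' mulrC.
  by apply: mem_mulset; [apply: Lx|apply: L'd].
have Xinv : invertible R X.
  split; first by apply: (frac_cap _ (fun T => - J T)) => // T /Jd[].
  exists X'; split.
    by apply: (frac_cap (fun T => - J T) J) => // T; [rewrite mulsetC|case/Jd].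
  apply: (jaffard_eq Theta_jaffard) => [||T ThT] //.
    by apply: submodule_mul; apply: submodule_over DR _; apply: cap_sub.
  by rewrite -{1}(mulset_id (@subset_refl _ T)) mulsetACA XT // X'T.
exists (cls (InvIdeal Xinv)) => T; rewrite pic_extE -Jz; congr cls; apply: val_inj.
rewrite -[LHS]/(mulset X (mul_ring R (val T))) ext_mul_ring; last exact: cap_sub.
exact/XT/set_mem/valP.
Qed.

End Descent.

(** Used for A = D, to embed Pic(D, Theta) in Pic(R), and for A = T, to recognize the classes of
    Pic(D, Theta) from their extensions to the RT. *)
Lemma pic_ext_mulr_inj A (DA : D `<=` A) (AK : A `<=` K) :
  injective (pic_ext (@sub_mulr _ R A)).
Proof.
apply: raddf_inj => v v0; have {v0} : pic_ext (@sub_mulr _ R A) v = 0 := v0.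
rewrite -[v]reprE pic_extE -(@cls0 _ (mul_ring R A)) => /clsP.
rewrite subr0 => -[y [_ y0 Ey]]; rewrite -(@cls0 _ A); apply/clsP; rewrite subr0.
apply: (principal_contraction DA AK (inv_idealP _) y0).
by rewrite -Ey -(ext_mul_ringr R (inv_submodule _)).
Qed.



(** * The exact sequence and the decomposition of [LPic] *)

Section ExactSequence.
Variable Theta : set (overring D).
Hypothesis Theta_jaffard : jaffard_family Theta.

Lemma pic_ext_square T v :
  pic_ext (@sub_mull _ R T) (pic_ext DR v) =
  pic_ext (@sub_mulr _ R T) (pic_ext (@overring_sub _ _ T) v).
Proof. by rewrite !(pic_ext_trans (subset_trans DR (@sub_mull _ R T))). Qed.

Lemma pic_exact : exists pi_Theta :
    {additive Pic R -> dsum (fun T : Theta => Pic (mul_ring R (val T)))},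
  (forall x (T : Theta),
     dsum_fun (pi_Theta x) T = pic_ext (@sub_mull _ R (val T)) x) /\
  short_exact (pic_ext DR \o (val : PicTheta Theta -> Pic D)) pi_Theta.
Proof.
pose p (T : Theta) : {additive Pic R -> Pic (mul_ring R (val T))} :=
  pic_ext (@sub_mull _ R (val T)).
pose pi_Theta : {additive Pic R -> dsum _} :=
  dsum_map (f := p) (pic_ext_finite Theta_jaffard).
have pi_ThetaE x (T : Theta) :
  dsum_fun (pi_Theta x) T = pic_ext (@sub_mull _ R (val T)) x by [].
exists pi_Theta; split=> //; split.
- apply: raddf_inj => v v0; apply: val_inj.
  have {}v0 : pic_ext DR (val v) = 0 := v0.
  (* The injectivity lemma concerns RD, so the vanishing in Pic(R) is first carried over to
     Pic(RD). *)
  apply: (pic_ext_mulr_inj (@subset_refl _ D) (@sub_frac _ D)).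
  by rewrite -(pic_ext_trans _ (@sub_mull _ R D) DR) v0 !raddf0.
- move=> x; split=> [x0|[[v vTheta] /= <-]].
    have xT T : Theta T -> pic_ext (@sub_mull _ R T) x = 0.
      by move=> /mem_set h; rewrite -(pi_ThetaE x (exist _ T h)) x0.
    have [|v vx] := pic_descent Theta_jaffard (x := x).
      by move=> T ThT; exists 0; rewrite raddf0 xT.
    have vTheta : v \in pic_theta_pred Theta.
      apply/mem_pic_theta => T ThT.
      apply: (pic_ext_mulr_inj (@overring_sub _ _ T) (@overring_frac _ _ T)).
      by rewrite -pic_ext_square vx raddf0 xT.
    by exists (exist _ v vTheta).
  have /mem_pic_theta v0 := vTheta.
  apply: dsum_eq => T; rewrite pi_ThetaE pic_ext_square v0 ?raddf0 //.
  exact: set_mem (valP T).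
- move=> z; have [x xz] := pic_gluing Theta_jaffard (dsumP z).
  by exists x; apply: dsum_eq.
Qed.

Let q (T : Theta) : {additive Pic R -> LPic (@sub_mulr _ R (val T))} :=
  \pi_(LPic (@sub_mulr _ R (val T))) \o pic_ext (@sub_mull _ R (val T)).

Local Lemma lpic_finite x : finite_set [set T | q T x != 0].
Proof.
apply: sub_finite_set (pic_ext_finite Theta_jaffard x) => T /=.
by apply: contraNneq => ->; rewrite raddf0.
Qed.

Local Lemma lpic_kill x : x \in pic_ext_im DR -> dsum_map lpic_finite x = 0.
Proof.
move=> /asboolP[v <-]; apply: dsum_eq => T; apply/eqP.
rewrite -[dsum_fun _ T]/(q T (pic_ext DR v)) /= quot_eq0 pic_ext_square.
by apply/asboolP; eexists.
Qed.

Lemma lpic_iso : exists f : {additive LPic DR ->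
    dsum (fun T : Theta => LPic (@sub_mulr _ R (val T)))}, bijective f.
Proof.
exists (quot_lift lpic_kill); apply: bijective_of_inj_surj.
  apply: raddf_inj => y; rewrite -[y]reprK; set x := repr y.
  move=> x0; have {}x0 : quot_lift lpic_kill (\pi x) = 0 := x0.
  apply/eqP; rewrite quot_eq0; apply/asboolP.
  apply: (pic_descent Theta_jaffard) => T /mem_set h.
  have : q (exist _ T h) x = 0.
    rewrite -[LHS]/(dsum_fun (dsum_map lpic_finite x) (exist _ T h)).
    by rewrite -(quot_liftE lpic_kill) x0.
  by move=> /eqP; rewrite /= quot_eq0 => /asboolP.
(* The chosen representative of 0 in the quotient need not be 0, so 0 is imposed there to keep the
   support finite. *)
move=> z; pose r (T : Theta) : Pic (mul_ring R (val T)) :=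
  if dsum_fun z T == 0 then 0 else repr (dsum_fun z T).
have r_fin : finite_set [set T | r T != 0].
  by apply: sub_finite_set (dsumP z) => T /=; apply: contra_neq => z0; rewrite /r z0 eqxx.
have [x xr] := pic_gluing Theta_jaffard r_fin.
exists (\pi_(Quotient.quot (pic_ext_im DR)) x).
rewrite [LHS](quot_liftE lpic_kill); apply: dsum_eq => T.
rewrite -[LHS]/(\pi_(LPic (@sub_mulr _ R (val T))) (pic_ext (@sub_mull _ R (val T)) x)).
rewrite xr /r.
by case: eqP => [->|_]; rewrite ?raddf0 ?reprK.
Qed.

End ExactSequence.
End PseudoPolynomial.

(** * Contraction of extended ideals along a retraction *)

Section RetractContraction.
Variables (D0 : idomainType) (R0 : idomAlgType D0).
Local Notation D := (embD R0).
Local Notation R := (embR R0).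
Local Notation K := (frac_ring D).

Definition emb (d : D0) : {fraction R0} := tofrac (d%:A : R0).

Lemma emb_is_zmod_morphism : zmod_morphism emb.
Proof. by move=> a b; rewrite /emb scalerBl rmorphB. Qed.
Lemma emb_is_monoid_morphism : monoid_morphism emb.
Proof.
split=> [|a b]; first by rewrite /emb scale1r rmorph1.
by rewrite /emb -rmorphM mulr_algl scalerA.
Qed.
HB.instance Definition _ :=
  GRing.isZmodMorphism.Build D0 {fraction R0} emb emb_is_zmod_morphism.
HB.instance Definition _ :=
  GRing.isMonoidMorphism.Build D0 {fraction R0} emb emb_is_monoid_morphism.

Lemma embR_frac x : frac_ring R x.
Proof.
elim/quotW: x => x; have dx0 : tofrac \d_x != 0 by rewrite tofrac_eq0 denom_ratioP.
exists (tofrac \n_x), (tofrac \d_x); split=> //.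
- by exists \n_x.
- by exists \d_x.
apply: (canRL (mulfK dx0)); unlock FracField.tofrac; rewrite -[LHS]FracField.pi_mul.
apply/eqmodP; rewrite /= FracField.equivfE.
by rewrite !numden_Ratio ?(oner_neq0, mulf_neq0, mulr1, denom_ratioP) // mulrC.
Qed.

Variable eps : {lrmorphism R0 -> D0^o}.

Definition retract (r : R0) : D0 := eps r.

Lemma retract0 : retract 0 = 0. Proof. exact: raddf0. Qed.
Lemma retract1 : retract 1 = 1. Proof. exact: rmorph1. Qed.
Lemma retractD r q : retract (r + q) = retract r + retract q.
Proof. exact: raddfD. Qed.
Lemma retractZ d r : retract (d%:A * r) = d * retract r.
Proof. by rewrite /retract mulr_algl linearZ. Qed.

(** The retraction sends the image of [d] in [R0] back to [d], so no nonzero element dies. *)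
Local Lemma emb_neq0 d : d != 0 -> emb d != 0.
Proof.
apply: contraNneq => /eqP; rewrite tofrac_eq0 => /eqP d0.
by have := retractZ d 1; rewrite [d%:A]d0 mul0r retract0 retract1 mulr1 => <-.
Qed.

(** The retraction extends to RK -> K by r/s |-> eps(r)/s; this fixes K and maps IR into [I].
    Instead of constructing that map, the proof shows that each element of IR has some expression
    r/s with eps(r)/s in [I]. *)
Lemma retract_contraction I : submodule D I -> I `<=` K -> mulset I R `&` K `<=` I.
Proof.
have emb_frac y : K y -> exists a b, emb b != 0 /\ y = emb a / emb b.
  by move=> [_ [_ [[a _ <-] [b _ <-] b0 ->]]]; exists a, b.
have addE (F : fieldType) (s t u v : F) : s != 0 -> t != 0 ->
    (t * u + s * v) / (s * t) = u / s + v / t.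
  by move=> s0 t0; field; rewrite s0 t0.
move=> [I0 ID IZ] IK x [IRx /emb_frac[a [b [b0 xE]]]].
have sub : mulset I R `<=` [set y | exists s r,
    [/\ s != 0, emb s * y = tofrac r & I (emb (retract r) / emb s)]].
  apply: mulset_min.
  - exists 1, 0; split; [exact: oner_neq0|by rewrite mulr0 rmorph0|].
    by rewrite retract0 rmorph0 mul0r.
  - move=> y z [s [r [s0 yE Ir]]] [t [q [t0 zE Iq]]].
    have [is0 it0] := (emb_neq0 s0, emb_neq0 t0).
    exists (s * t), (t%:A * r + s%:A * q); split; first exact: mulf_neq0.
      rewrite tofracD !tofracM -yE -zE -[tofrac t%:A]/(emb t) -[tofrac s%:A]/(emb s).
      by rewrite rmorphM mulrDr [emb s * _ * y]mulrAC mulrC -[emb s * _ * z]mulrA.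
    by rewrite retractD !retractZ rmorphD !rmorphM addE //; apply: ID.
  - move=> m _ Im [r _ <-]; have [c [d [d0 mE]]] := emb_frac m (IK m Im).
    exists d, (c%:A * r); split.
    + by apply: contraNneq d0 => ->; rewrite rmorph0.
    + by rewrite mE tofracM -[tofrac c%:A]/(emb c) mulrA [emb d * _]mulrC mulfVK.
    + by rewrite retractZ rmorphM mulrAC -mE mulrC; apply: IZ => //; eexists.
have [s [r [s0 sx Ir]]] := sub x IRx.
suff -> : x = emb (retract r) / emb s by [].
have is0 := emb_neq0 s0.
(* The expressions r/s and a/b of [x] are compared: retracting br = sa gives b eps(r) = sa, so
   eps(r)/s is [x] itself. *)
have /(congr1 retract) : b%:A * r = s%:A * a%:A.
  apply/eqP; rewrite -tofrac_eq !tofracM -sx xE mulrCA; apply/eqP.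
  by rewrite [tofrac b%:A * _]mulrC mulfVK.
rewrite !retractZ -[a%:A]mulr1 retractZ retract1 mulr1 => /(congr1 emb).
rewrite !rmorphM => E; rewrite xE; apply/eqP.
by rewrite eqr_div // mulrC -E mulrC.
Qed.

End RetractContraction.

(** * Application to pseudo-polynomial retract algebras *)

Theorem corollary7p5 (D0 : idomainType) (R0 : idomAlgType D0)
    (D := embD R0) (R := embR R0) (K := frac_ring D)
    (DR : D `<=` R := @embDR D0 R0)
    (D_not_field : D <> K :> set {fraction R0})
    (R_retract : retract_algebra R0)
    (R_pseudo_polynomial : pseudo_polynomial D R)
    (PicRK_trivial : forall x : Pic (mul_ring R K), x = 0)
    (Theta : set (overring D))
    (Theta_jaffard : jaffard_family Theta) :
  (exists pi_Theta :
       {additive Pic R -> dsum (fun T : Theta => Pic (mul_ring R (val T)))},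
     (forall (x : Pic R) (T : Theta),
        dsum_fun (pi_Theta x) T = pic_ext (@sub_mull _ R (val T)) x) /\
     short_exact (pic_ext DR \o (val : PicTheta Theta -> Pic D)) pi_Theta)
  /\
  (exists f : {additive LPic DR ->
                 dsum (fun T : Theta => LPic (@sub_mulr _ R (val T)))},
     bijective f).
Proof.
have [eps] := R_retract; have contr := @retract_contraction _ _ eps.
split.
  exact: (pic_exact DR (@embR_frac _ R0) contr R_pseudo_polynomial PicRK_trivial).
exact: (lpic_iso DR (@embR_frac _ R0) contr R_pseudo_polynomial PicRK_trivial).
Qed.
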